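(* Assume the Riemann Hypothesis for $\zeta(s)$. Let $c>1$ and let $k\ge6$ be an even integer. Define, for $y\ge0$, \[ \mathcal{M}^k_c(y):=\Big(\int_1^c\mathcal{M}_k\big(\tfrac yu\big)u^2\frac{du}{u}\Big)\Big/\Big(\int_1^c u^2\frac{du}{u}\Big). \] Then $\mathcal{M}^k_c$ is continuous on $(0,\infty)$, $\mathcal{M}^k_c(0)=0$, and as $y\to\infty$, $\mathcal{M}^k_c(y)=\frac12+o_k(1)$.
   Context: For $y>0$, \[\mathcal{M}_k(y)=\frac{\alpha(-1)^{k/2-1}}{k-1}\sum_{1\le r\le 2\sqrt y}\nu(r)\sqrt{4y-r^2}\,U_{k-2}\Big(\frac{r}{2\sqrt y}\Big)+\frac{\beta}{k-1}\sqrt y-\gamma\,\delta_{k=2}\,y,\] and $\mathcal{M}_k(0)=0$, where $U_n(\cos\theta)=\sin((n+1)\theta)/\sin\theta$ is the Chebyshev polynomial, $\delta_{k=2}$ is $1$ if $k=2$ and $0$ otherwise, $\alpha=2\pi\prod_p\frac{1-p-2p^2+p^4}{p^4-2p^2+p}$, $\beta=2\pi\prod_p\frac{-1+p^2+p^3}{p(-1+p+p^2)}$, $\gamma=12\prod_p\frac{p(1+p)}{-1+p+p^2}$ (products over all primes), and $\nu(r)=\prod_{p\mid r}\big(1+\frac{p^2}{p^4-2p^2-p+1}\big)$. *)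

(* Defs.v *)
From Stdlib Require Import Reals Lra.
From mathcomp Require Import all_boot.
From Coquelicot Require Import Coquelicot.

Set Implicit Arguments.
Unset Strict Implicit.
Unset Printing Implicit Defensive.

Open Scope R_scope.

(* [n_pow_opp n s] is n^(-s) = exp (- s * ln n), for n >= 1. *)
Definition n_pow_opp (n : nat) (s : C) : C :=
  Cmult (RtoC (exp (- Re s * ln (INR n))))
        (cos (Im s * ln (INR n)), - sin (Im s * ln (INR n))).

(* The Riemann zeta function, as the analytic continuation to C \ {1} of its
   Dirichlet series. It is unique away from s = 1, where no value is imposed. *)
Definition is_riemann_zeta (zeta : C -> C) : Prop :=
  (forall s : C, 1 < Re s ->
     @is_series C_AbsRing C_NormedModule (fun n => n_pow_opp n.+1 s) (zeta s))
  /\ (forall s : C, s <> RtoC 1 -> @ex_derive C_AbsRing C_NormedModule zeta s).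

Definition trivial_zero (s : C) : Prop :=
  exists n : nat, (0 < n)%N /\ s = RtoC (- 2 * INR n).

Definition RiemannHypothesis : Prop :=
  forall zeta : C -> C, is_riemann_zeta zeta ->
  forall s : C, s <> RtoC 1 -> zeta s = RtoC 0 -> ~ trivial_zero s ->
  Re s = 1 / 2.

Definition euler_product (f : nat -> R) : R :=
  real (Lim_seq (fun N => \big[Rmult/1]_(0 <= p < N | prime p) f p)).

Definition alpha : R :=
  2 * PI * euler_product (fun n => let p := INR n in
    (1 - p - 2 * p ^ 2 + p ^ 4) / (p ^ 4 - 2 * p ^ 2 + p)).

Definition beta : R :=
  2 * PI * euler_product (fun n => let p := INR n in
    (- 1 + p ^ 2 + p ^ 3) / (p * (- 1 + p + p ^ 2))).

Definition gamma : R :=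
  12 * euler_product (fun n => let p := INR n in
    p * (1 + p) / (- 1 + p + p ^ 2)).

Definition nu (r : nat) : R :=
  \big[Rmult/1]_(q <- primes r)
    (let p := INR q in 1 + p ^ 2 / (p ^ 4 - 2 * p ^ 2 - p + 1)).

Fixpoint chebyshevU (n : nat) (x : R) : R :=
  match n with
  | 0%N => 1
  | n1.+1 => match n1 with
             | 0%N => 2 * x
             | n2.+1 => 2 * x * chebyshevU n1 x - chebyshevU n2 x
             end
  end.

Lemma chebyshevU_cos (n : nat) (t : R) : sin t <> 0 ->
  chebyshevU n (cos t) = sin ((INR n + 1) * t) / sin t.
Proof.
move=> st.
suff H m : chebyshevU m (cos t) = sin ((INR m + 1) * t) / sin t /\
  chebyshevU m.+1 (cos t) = sin ((INR m.+1 + 1) * t) / sin t by case: (H n).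
elim: m => [|m [IH0 IH1]].
  split; rewrite /= ?Rplus_0_l ?Rmult_1_l; first by field.
  by rewrite (_ : (1 + 1) * t = 2 * t); [rewrite sin_2a; field | ring].
split=> //.
have -> : chebyshevU m.+2 (cos t)
  = 2 * cos t * chebyshevU m.+1 (cos t) - chebyshevU m (cos t) by [].
rewrite IH0 IH1 !S_INR.
set a := (INR m + 1 + 1) * t.
rewrite (_ : (INR m + 1) * t = a - t); last by rewrite /a; ring.
rewrite (_ : (INR m + 1 + 1 + 1) * t = a + t); last by rewrite /a; ring.
by rewrite sin_plus sin_minus; field.
Qed.

(* The index r runs over 1 <= r <= floor (2 sqrt y). *)
Definition calM (k : nat) (y : R) : R :=
  if Rlt_dec 0 y then
    alpha * (- 1) ^ (k./2 - 1)%N / (INR k - 1) *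
      (\big[Rplus/0]_(1 <= r < (Z.to_nat (Int_part (2 * sqrt y))).+1)
         (nu r * sqrt (4 * y - INR r ^ 2) *
          chebyshevU (k - 2)%N (INR r / (2 * sqrt y))))
    + beta / (INR k - 1) * sqrt y
    - gamma * (if k == 2%N then 1 else 0) * y
  else 0.

Definition calM_avg (c : R) (k : nat) (y : R) : R :=
  RInt (fun u => calM k (y / u) * u ^ 2 / u) 1 c / RInt (fun u => u ^ 2 / u) 1 c.

(* Main.v *)
(** Write [k = 2j + 2], [n = 2j + 1] and [Z = 2 sqrt y]. Substituting
    [r = Z cos t] turns the summand of [calM] into [nu r * Z * sin (n t)], so that
    [calM y = alpha (-1)^j Z K'(Z)], where
    [K Z = sum_r nu r * r * ramp_moment (Z / r) + G (-1)^j / n * Z / 2],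
    [G = prod_p (1 + g p) = beta / alpha], and [1 + g p] is the local factor of [nu].
    Integrating by parts in [u], the average of [calM] becomes an integral of
    differences [K (lam Z) - K Z], and everything reduces to
    [K (lam Z) - K Z --> A (-1)^j (PI / 24) ln lam], where
    [A = prod_p (1 + p g p) (1 - 1/p)] and [alpha A = 2 PI / zeta 2 = 12 / PI].

    If [nu] is replaced by [1] and [G] by [1], then [K] is the integral [kappa] of the
    trigonometric polynomial [cos (n t) / cos t] against a periodic quadratic function
    of [Z cos t], and [kappa Z = (-1)^j PI / 24 + O(Z^(-1/2))] by integration by parts.
    Hence [sum_d kappa (Z / d) / d] grows logarithmically, with slope [(-1)^j PI / 24].
    Sieving out of this sum the [d] divisible by a prime [p] is the operator
    [1 - S_p / p], with [S_p K (Z) = K (Z / p)], and putting the factor [1 + g p] into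
    [nu] is [1 + p g p S_p]. Done together for one prime after the other, these steps
    lead from [sum_d kappa (Z / d) / d] to [K]; the coefficients of
    [(1 - S_p / p) (1 + p g p S_p) - 1] are [O(p^-2)], so that the steps converge
    uniformly. *)

Require Import Defs.
From Stdlib Require Import Reals Lra Lia ZArith.
From mathcomp Require Import all_boot zify Rstruct.
From Coquelicot Require Import Coquelicot.

Set Implicit Arguments.
Unset Strict Implicit.
Unset Printing Implicit Defensive.

Open Scope R_scope.

(** * Calculus on intervals *)

Lemma INR_gt0 (n : nat) : (0 < n)%N -> 0 < INR n.
Proof. by move=> n0; apply: lt_0_INR; lia. Qed.

Lemma INR_ge1 (n : nat) : (0 < n)%N -> 1 <= INR n.
Proof. by move=> n0; apply: (le_INR 1); lia. Qed.

Lemma sqrt_ge1 (x : R) : 1 <= x -> 1 <= sqrt x.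
Proof. by move=> x1; rewrite -sqrt_1; apply: sqrt_le_1_alt. Qed.

Lemma ln_ge0 (x : R) : 1 <= x -> 0 <= ln x.
Proof. by move=> x1; rewrite -ln_1; apply: ln_le; lra. Qed.

Lemma ex_derive_continuousR (f : R -> R) (x : R) : ex_derive f x -> continuous f x.
Proof. exact: ex_derive_continuous. Qed.

Lemma is_derive_continuous (f : R -> R) (x l : R) : is_derive f x l -> continuous f x.
Proof. by move=> Df; apply: ex_derive_continuousR; exists l. Qed.

Lemma is_lim_seq_dist_le (u v : nat -> R) (l m a : R) :
  eventually (fun n => Rabs (u n - a) <= v n) ->
  is_lim_seq u l -> is_lim_seq v m -> Rabs (l - a) <= m.
Proof.
move=> uv ul vm.
have ul_abs : is_lim_seq (fun n => Rabs (u n - a)) (Rabs (l - a)).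
  apply: (is_lim_seq_abs _ (Finite (l - a))).
  by apply: is_lim_seq_minus' => //; apply: is_lim_seq_const.
exact: (is_lim_seq_le_loc _ _ _ _ uv ul_abs vm).
Qed.

Lemma is_lim_seq_div_INR (a : R) : is_lim_seq (fun n => a / INR n) 0.
Proof.
have inv0 : is_lim_seq (fun n => / INR n) 0.
  by apply: (is_lim_seq_inv _ p_infty) => //; apply: is_lim_seq_INR.
by have := is_lim_seq_scal_l _ a _ inv0; rewrite /= Rmult_0_r.
Qed.

Lemma eventually_div_INR_lt (a eps : R) : 0 < eps -> eventually (fun n => a / INR n < eps).
Proof.
move=> eps0; have /is_lim_seq_spec /(_ (mkposreal _ eps0)) [N near] := is_lim_seq_div_INR a.
by exists N => n /near; rewrite Rminus_0_r => /Rabs_lt_between [].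
Qed.

Lemma mean_value (f df : R -> R) (a b : R) : a <= b ->
  (forall x, a <= x <= b -> is_derive f x (df x)) ->
  exists2 x, a <= x <= b & f b - f a = df x * (b - a).
Proof.
move=> ab Df; have [x|x|x] := MVT_gen f a b df.
- by rewrite Rmin_left ?Rmax_right // => xab; apply: Df; lra.
- rewrite Rmin_left ?Rmax_right // => xab.
  exact/continuity_pt_filterlim/(is_derive_continuous (Df x xab)).
by rewrite Rmin_left ?Rmax_right // => -[]; exists x.
Qed.

Lemma is_derive_punctured (f df : R -> R) (x : R) :
  continuous f x -> continuous df x -> locally' x (fun y => is_derive f y (df y)) ->
  is_derive f x (df x).
Proof.
move=> cf cdf [[r r0] near_x]; apply/is_derive_Reals => eps eps0.
have := cdf _ (locally_ball (df x) (mkposreal _ eps0)) => -[[d d0] near_df].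
have rd0 : 0 < Rmin r d by apply: Rmin_pos.
have [rd_r rd_d] := (Rmin_l r d, Rmin_r r d).
move: (Rmin r d) rd0 rd_r rd_d => e e0 e_r e_d.
exists (mkposreal e e0) => h h0 /= /Rabs_lt_between h_e.
have near y : Rmin x (x + h) <= y <= Rmax x (x + h) -> Rabs (y - x) < e.
  by rewrite /Rmin /Rmax; case: Rle_dec => _ yb; apply/Rabs_lt_between; lra.
have Df y : Rmin x (x + h) <= y <= Rmax x (x + h) -> y <> x -> is_derive f y (df y).
  by move=> yb yx; apply: near_x => //; apply: Rlt_le_trans (near y yb) e_r.
have [y yb|y yb|y [yb ->]] := MVT_gen f x (x + h) df.
- by apply: Df; [lra|move: yb; rewrite /Rmin /Rmax; case: Rle_dec; lra].
- apply/continuity_pt_filterlim; have [->//|yx] := Req_dec y x.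
  exact: is_derive_continuous (Df y yb yx).
rewrite (_ : df y * (x + h - x) / h = df y); last by field.
by apply: near_df; apply: Rlt_le_trans (near y yb) e_d.
Qed.

Definition lipschitz (C : R) (f : R -> R) : Prop :=
  forall x y, Rabs (f x - f y) <= C * Rabs (x - y).

Lemma lipschitz_continuous (C : R) (f : R -> R) (x : R) : lipschitz C f -> continuous f x.
Proof.
move=> lip; apply/continuity_pt_filterlim => eps eps0.
have C1 : 0 < Rabs C + 1 by have := Rabs_pos C; lra.
exists (eps / (Rabs C + 1)); split; first exact: Rdiv_lt_0_compat.
move=> y [_] /=; rewrite /R_dist => /Rlt_div_r -/(_ C1) yx.
apply: Rle_lt_trans (lip y x) (Rle_lt_trans _ _ _ _ yx).
by rewrite Rmult_comm; apply: Rmult_le_compat_l; [exact: Rabs_pos|have := Rle_abs C; lra].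
Qed.

Lemma lipschitz_linear (C v : R) (f : R -> R) : lipschitz C f -> f 0 = 0 -> 0 <= v ->
  Rabs (f v) <= C * v.
Proof.
by move=> lip f0 v0; have := lip v 0; rewrite f0 !Rminus_0_r (Rabs_right v); lra.
Qed.

Lemma is_RInt_antiderivative (F f : R -> R) (a b : R) : a <= b ->
  (forall x, a <= x <= b -> is_derive F x (f x)) ->
  (forall x, a <= x <= b -> continuous f x) -> is_RInt f a b (F b - F a).
Proof. by move=> ab DF cf; apply: is_RInt_derive; rewrite Rmin_left ?Rmax_right. Qed.

Lemma ex_RInt_continuous_le (f : R -> R) (a b : R) : a <= b ->
  (forall x, a <= x <= b -> continuous f x) -> ex_RInt f a b.
Proof.
move=> ab cf; apply: ex_RInt_continuous => x; rewrite Rmin_left ?Rmax_right //.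
exact: cf.
Qed.

Lemma is_RInt_eq (f g : R -> R) (a b l l' : R) : a <= b ->
  (forall x, a < x < b -> f x = g x) -> l = l' -> is_RInt f a b l -> is_RInt g a b l'.
Proof.
move=> ab fg ->; apply: is_RInt_ext => x; rewrite Rmin_left ?Rmax_right //.
exact: fg.
Qed.

Lemma is_RInt_zero (a b : R) : is_RInt (fun=> 0) a b 0.
Proof. by have := is_RInt_const a b (0 : R); rewrite /scal /= /mult /= Rmult_0_r. Qed.
Arguments is_RInt_zero : clear implicits.

(* Coquelicot states these with the operations of a module, which [ring] and [field]
   do not recognise as those of [R]. *)
Lemma is_RInt_Rplus (f g : R -> R) (a b lf lg : R) : is_RInt f a b lf ->
  is_RInt g a b lg -> is_RInt (fun x => f x + g x) a b (lf + lg).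
Proof. exact: is_RInt_plus. Qed.

Lemma is_RInt_Rminus (f g : R -> R) (a b lf lg : R) : is_RInt f a b lf ->
  is_RInt g a b lg -> is_RInt (fun x => f x - g x) a b (lf - lg).
Proof. exact: is_RInt_minus. Qed.

Lemma is_RInt_Rscal (c : R) (f : R -> R) (a b l : R) :
  is_RInt f a b l -> is_RInt (fun x => c * f x) a b (c * l).
Proof. exact: is_RInt_scal. Qed.
Arguments is_RInt_Rscal c {f a b l}.

Lemma big_nat_additive (Rel : (R -> R) -> R -> Prop) (F : nat -> R -> R) (l : nat -> R)
    (m n : nat) :
  (forall f g a, (forall x, f x = g x) -> Rel f a -> Rel g a) -> Rel (fun=> 0) 0 ->
  (forall f g a b, Rel f a -> Rel g b -> Rel (fun x => f x + g x) (a + b)) ->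
  (forall i, (m <= i < n)%N -> Rel (F i) (l i)) ->
  Rel (fun x => \big[Rplus/0]_(m <= i < n) F i x) (\big[Rplus/0]_(m <= i < n) l i).
Proof.
move=> Rel_ext Rel0 RelD RelF; rewrite big_nat.
apply: (Rel_ext (fun x => \big[Rplus/0]_(m <= i < n | (m <= i < n)%N) F i x)).
  by move=> x; rewrite -big_nat.
elim: (index_iota m n) => [|i s IH].
  by rewrite big_nil; apply: Rel_ext Rel0 => x; rewrite big_nil.
rewrite big_cons; case: ifP => imn; last by apply: Rel_ext IH => x; rewrite big_cons imn.
by apply: Rel_ext (RelD _ _ _ _ (RelF i imn) IH) => x; rewrite big_cons imn.
Qed.

Lemma is_RInt_big_nat (F : nat -> R -> R) (l : nat -> R) (a b : R) (m n : nat) :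
  (forall i, (m <= i < n)%N -> is_RInt (F i) a b (l i)) ->
  is_RInt (fun x => \big[Rplus/0]_(m <= i < n) F i x) a b (\big[Rplus/0]_(m <= i < n) l i).
Proof.
apply: (big_nat_additive (Rel := fun f l => is_RInt f a b l)).
- by move=> f g lf fg; apply: is_RInt_ext => x _; apply: fg.
- exact: is_RInt_zero.
- by move=> f g lf lg; apply: is_RInt_Rplus.
Qed.

Lemma is_derive_big_nat (F : nat -> R -> R) (dF : nat -> R) (m n : nat) (x : R) :
  (forall i, (m <= i < n)%N -> is_derive (F i) x (dF i)) ->
  is_derive (fun x => \big[Rplus/0]_(m <= i < n) F i x) x (\big[Rplus/0]_(m <= i < n) dF i).
Proof.
apply: (big_nat_additive (Rel := fun f l => is_derive f x l)).
- by move=> f g lf fg; apply: is_derive_ext.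
- exact: is_derive_const.
- by move=> f g lf lg; apply: is_derive_plus.
Qed.

Lemma continuous_big_nat (F : nat -> R -> R) (m n : nat) (x : R) :
  (forall i, (m <= i < n)%N -> continuous (F i) x) ->
  continuous (fun x => \big[Rplus/0]_(m <= i < n) F i x) x.
Proof.
apply: (big_nat_additive (Rel := fun f _ => continuous f x) (l := fun=> 0)).
- by move=> f g _ fg; apply: continuous_ext.
- exact: continuous_const.
- by move=> f g _ _; apply: continuous_plus.
Qed.

(** * Sequences with increments of order [1 / n ^ 2] *)

Lemma telescoping_dist (u v : nat -> R) (m n : nat) : (m <= n)%N ->
  (forall i, (m <= i)%N -> Rabs (u i.+1 - u i) <= v i - v i.+1) ->
  Rabs (u n - u m) <= v m - v n.
Proof.
move=> /subnK <- du; elim: (n - m)%N => [|i IH].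
  by rewrite add0n !Rminus_diag Rabs_R0; lra.
rewrite addSn; have := du (i + m)%N (leq_addl _ _).
have := Rabs_triang (u (i + m).+1 - u (i + m)%N) (u (i + m)%N - u m).
by rewrite (_ : _ + _ = u (i + m).+1 - u m); [lra|ring].
Qed.

Lemma inv_square_le (n : nat) : / INR n.+1 ^ 2 <= 2 * (/ INR n.+1 - / INR n.+2).
Proof.
have n1 := INR_ge1 (ltn0Sn n); rewrite [INR n.+2]S_INR; set x := INR n.+1 in n1 *.
rewrite (_ : 2 * _ = / (x * (x + 1) / 2)); last by field; lra.
by apply: Rinv_le_contravar; nra.
Qed.

Section InverseSquareIncrements.
Variables (u : nat -> R) (C : R).
Hypothesis increments : forall n, Rabs (u n.+1 - u n) <= C / INR n.+1 ^ 2.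

Lemma inv_square_increments_dist (m n : nat) : (m <= n)%N ->
  Rabs (u n - u m) <= 2 * C / INR m.+1.
Proof.
have C0 : 0 <= C.
  by have := increments 0; rewrite pow1; have := Rabs_pos (u 1%N - u 0%N); lra.
move=> mn; apply: Rle_trans (telescoping_dist (v := fun n => 2 * C / INR n.+1) mn _) _.
  move=> i _; apply: Rle_trans (increments i) _.
  have -> : 2 * C / INR i.+1 - 2 * C / INR i.+2 = C * (2 * (/ INR i.+1 - / INR i.+2)).
    by rewrite /Rdiv; ring.
  exact: Rmult_le_compat_l (inv_square_le i).
have : 0 <= 2 * C / INR n.+1 by apply: Rdiv_le_0_compat; [lra|exact: INR_gt0].
lra.
Qed.

Lemma inv_square_increments_cv : is_lim_seq u (real (Lim_seq u)).
Proof.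
apply: Lim_seq_correct'; apply/ex_lim_seq_cauchy_corr => eps.
have eps2 : 0 < eps / 2 by have := cond_pos eps; lra.
have [N tail_lt] := eventually_div_INR_lt (2 * C) eps2.
have near n : (N <= n)%coq_nat -> Rabs (u n - u N) < eps / 2.
  move=> Nn; apply: Rle_lt_trans (inv_square_increments_dist _) _; first lia.
  by apply: tail_lt; lia.
exists N => n m Nn Nm; have := Rabs_triang (u n - u N) (- (u m - u N)).
by rewrite Rabs_Ropp (_ : _ + - _ = u n - u m); have := near n Nn; have := near m Nm; lra.
Qed.

Lemma inv_square_increments_tail (n : nat) :
  Rabs (real (Lim_seq u) - u n) <= 2 * C / INR n.+1.
Proof.
apply: (is_lim_seq_dist_le _ inv_square_increments_cv (is_lim_seq_const _)).
by exists n => m nm; apply: inv_square_increments_dist; lia.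
Qed.

End InverseSquareIncrements.

(* Discrete Gronwall: [Q n K] is meant to say that the [n]-th member of some family is
   bounded by [K]. *)
Lemma inv_square_growth (Q : nat -> R -> Prop) (B C : R) : 0 <= B -> 0 <= C -> Q 0%N B ->
  (forall n K, Q n K -> Q n.+1 ((1 + C / INR n.+1 ^ 2) * K)) ->
  forall n, exists2 K, 0 <= K <= B * exp (2 * C) & Q n K.
Proof.
move=> B0 C0 QB Q_step n.
suff [K [K0 KB] QK] : exists2 K, 0 <= K <= B * exp (2 * C * (1 - / INR n.+1)) & Q n K.
  exists K => //; split=> //; apply: Rle_trans KB _; apply: Rmult_le_compat_l => //.
  have i0 : 0 < / INR n.+1 by apply: Rinv_0_lt_compat; apply: INR_gt0.
  have [->|neq] := Req_dec C 0; first by rewrite Rmult_0_r Rmult_0_l; lra.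
  by left; apply: exp_increasing; nra.
elim: n => [|n [K [K0 KB] QK]].
  by exists B => //; rewrite /= Rinv_1 Rminus_diag Rmult_0_r exp_0; lra.
have C2 : 0 <= C / INR n.+1 ^ 2.
  by apply: Rdiv_le_0_compat => //; apply: pow_lt; apply: INR_gt0.
exists ((1 + C / INR n.+1 ^ 2) * K); last exact: Q_step.
split; first by apply: Rmult_le_pos; lra.
have -> : 2 * C * (1 - / INR n.+2) =
    2 * C * (1 - / INR n.+1) + C * (2 * (/ INR n.+1 - / INR n.+2)) by ring.
rewrite exp_plus -Rmult_assoc Rmult_comm.
apply: Rmult_le_compat => //; first lra.
apply: Rle_trans (exp_ineq1_le _); apply: Rplus_le_compat_l.
exact: Rmult_le_compat_l (inv_square_le n).
Qed.

Lemma inv_square_prod_cv (e : nat -> R) (C : R) :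
  (forall n, Rabs (e n) <= C / INR n.+1 ^ 2) ->
  ex_finite_lim_seq (fun N => \big[Rmult/1]_(0 <= n < N) (1 + e n)).
Proof.
move=> eC; set P := (fun N => \big[Rmult/1]_(0 <= n < N) (1 + e n)).
have PS n : P n.+1 = P n * (1 + e n) by rewrite /P big_nat_recr.
have C0 : 0 <= C by have := eC 0%N; rewrite pow1; have := Rabs_pos (e 0%N); lra.
have P_step n K : Rabs (P n) <= K -> Rabs (P n.+1) <= (1 + C / INR n.+1 ^ 2) * K.
  move=> PK; rewrite PS Rabs_mult Rmult_comm.
  apply: Rmult_le_compat => //; try exact: Rabs_pos.
  by apply: Rle_trans (Rabs_triang _ _) _; rewrite Rabs_R1; have := eC n; lra.
have P0 : Rabs (P 0%N) <= 1 by rewrite /P big_geq // Rabs_R1; lra.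
have bounded := inv_square_growth Rle_0_1 C0 P0 P_step.
exists (real (Lim_seq P)); apply: (@inv_square_increments_cv _ (exp (2 * C) * C)) => n.
rewrite PS (_ : _ - _ = P n * e n); last by ring.
rewrite Rabs_mult /Rdiv Rmult_assoc; apply: Rmult_le_compat (eC n); try exact: Rabs_pos.
by have [K [_ KB] PK] := bounded n; rewrite Rmult_1_l in KB; apply: Rle_trans PK KB.
Qed.

(** * Euler products *)

Definition prime_prod (f : nat -> R) (N : nat) : R :=
  \big[Rmult/1]_(0 <= p < N | prime p) f p.

Lemma prime_prodS (f : nat -> R) (N : nat) :
  prime_prod f N.+1 = prime_prod f N * (if prime N then f N else 1).
Proof. by rewrite /prime_prod big_mkcond big_nat_recr //= -big_mkcond. Qed.

Definition euler_convergent (f : nat -> R) : Prop :=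
  exists C, forall p, prime p -> Rabs (f p - 1) <= C / INR p.+1 ^ 2.

Lemma is_lim_euler_product (f : nat -> R) : euler_convergent f ->
  is_lim_seq (prime_prod f) (euler_product f).
Proof.
move=> [C fC]; apply: Lim_seq_correct'.
have [|l fl] := @inv_square_prod_cv (fun p => if prime p then f p - 1 else 0) (Rmax C 0).
  move=> n; have n2 : 0 < INR n.+1 ^ 2 by apply: pow_lt; apply: INR_gt0.
  case: ifP => [/fC fn|_]; last first.
    by rewrite Rabs_R0; apply: Rdiv_le_0_compat => //; apply: Rmax_r.
  apply: Rle_trans fn _; apply: Rmult_le_compat_r; last exact: Rmax_l.
  by left; apply: Rinv_0_lt_compat.
exists l; apply: is_lim_seq_ext fl => N; rewrite /prime_prod [RHS]big_mkcond.
by apply: eq_bigr => p _; case: ifP => _; ring.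
Qed.

Lemma euler_product_unique (f : nat -> R) (l : R) :
  is_lim_seq (prime_prod f) l -> euler_product f = l.
Proof. by move=> fl; rewrite /euler_product (is_lim_seq_unique _ _ fl). Qed.

Lemma eq_euler_product (f g : nat -> R) : (forall p, prime p -> f p = g p) ->
  euler_product f = euler_product g.
Proof. by move=> fg; congr real; apply: Lim_seq_ext => N; apply: eq_bigr. Qed.

Lemma euler_productM (f g : nat -> R) : euler_convergent f -> euler_convergent g ->
  euler_product (fun p => f p * g p) = euler_product f * euler_product g.
Proof.
move=> cf cg; apply: euler_product_unique.
have := is_lim_seq_mult' _ _ _ _ (is_lim_euler_product cf) (is_lim_euler_product cg).
by apply: is_lim_seq_ext => N; rewrite /prime_prod big_split.
Qed.

(** * Sums over rough numbers *)

Lemma big_multiples (F : nat -> R) (P : pred nat) (p M : nat) : (0 < p)%N ->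
  \big[Rplus/0]_(1 <= n < (p * M).+1 | P n && (p %| n)%N) F n =
  \big[Rplus/0]_(1 <= m < M.+1 | P (p * m)%N) F (p * m)%N.
Proof.
move=> p0; rewrite big_mkcondl -big_filter [RHS]big_mkcond.
rewrite -(big_map (muln p) xpredT (fun n => if P n then F n else 0)); apply: perm_big.
apply: uniq_perm; first exact/filter_uniq/iota_uniq.
  by rewrite map_inj_uniq ?iota_uniq // => i j /eqP; rewrite eqn_pmul2l // => /eqP.
move=> n; rewrite mem_filter mem_index_iota.
apply/andP/mapP => [[/dvdnP [m ->]]|[m]].
  rewrite ltnS mulnC muln_gt0 leq_pmul2l // => /andP [/andP [_ m0] mM].
  by exists m => //; rewrite mem_index_iota m0.
rewrite mem_index_iota => /andP [m0 mM] ->.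
by rewrite dvdn_mulr // muln_gt0 p0 m0 ltnS leq_pmul2l.
Qed.

Definition rough (N d : nat) : bool :=
  all (fun p => prime p ==> ~~ (p %| d)%N) (seq.iota 0 N).

Lemma roughP (N d : nat) :
  reflect (forall p, (p < N)%N -> prime p -> ~~ (p %| d)%N) (rough N d).
Proof.
apply: (iffP allP) => rNd p.
  by move=> pN pp; have := rNd p; rewrite mem_iota add0n pN pp; apply.
by rewrite mem_iota add0n => /andP [_ pN]; apply/implyP; apply: rNd.
Qed.

Lemma roughS (N d : nat) : rough N.+1 d = rough N d && (prime N ==> ~~ (N %| d)%N).
Proof. by rewrite /rough -addn1 iotaD all_cat /= add0n andbT. Qed.

Lemma rough1 (N : nat) : rough N 1.
Proof. by apply/roughP => p _ pp; rewrite dvdn1; case: p pp => [|[|]]. Qed.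

Lemma rough_eq1 (N d : nat) : (0 < d < N)%N -> rough N d = (d == 1%N).
Proof.
move=> /andP [d0 dN]; apply/idP/eqP => [/roughP rough_d|->]; last exact: rough1.
apply/eqP; rewrite eqn_leq d0 andbT leqNgt; apply/negP => d1.
have := rough_d (pdiv d) (leq_ltn_trans (pdiv_leq d0) dN) (pdiv_prime d1).
by rewrite pdiv_dvd.
Qed.

Lemma rough_mulp (p m : nat) : prime p -> rough p (p * m) = rough p m.
Proof.
move=> pp; apply/roughP/roughP => rough_m q qp qq; have := rough_m q qp qq; apply: contra.
  exact: dvdn_mull.
rewrite Euclid_dvdM // => /orP [|//]; rewrite dvdn_prime2 // => /eqP qE.
by rewrite qE ltnn in qp.
Qed.

Definition rough_sum (N : nat) (F : nat -> R) (M : nat) : R :=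
  \big[Rplus/0]_(1 <= d < M.+1 | rough N d) F d.

Definition rough_series (N : nat) (F : nat -> R) : R := real (Lim_seq (rough_sum N F)).

Definition inv_square_bounded (C : R) (F : nat -> R) : Prop :=
  forall d, (0 < d)%N -> Rabs (F d) <= C / INR d ^ 2.

Lemma rough_sumS (N : nat) (F : nat -> R) (M : nat) :
  rough_sum N F M.+1 = rough_sum N F M + (if rough N M.+1 then F M.+1 else 0).
Proof. by rewrite /rough_sum big_mkcond big_nat_recr // -big_mkcond. Qed.

Lemma rough_sum_prime (p : nat) (F : nat -> R) (M : nat) : prime p ->
  rough_sum p F (p * M) = rough_sum p.+1 F (p * M) + rough_sum p (fun d => F (p * d)%N) M.
Proof.
move=> pp; rewrite /rough_sum (bigID (fun d => p %| d)%N) /= big_multiples ?prime_gt0 //.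
rewrite Rplus_comm; congr (_ + _); apply: eq_bigl => d; last by rewrite rough_mulp.
by rewrite roughS pp.
Qed.

Section RoughSeries.
Variables (C : R) (F : nat -> R).
Hypothesis F_bounded : inv_square_bounded C F.

Lemma rough_sum_increments (N n : nat) :
  Rabs (rough_sum N F n.+1 - rough_sum N F n) <= C / INR n.+1 ^ 2.
Proof.
rewrite rough_sumS (_ : _ + ?[x] - _ = ?x); last by ring.
case: ifP => _; first exact: F_bounded.
by rewrite Rabs_R0; apply: Rle_trans (Rabs_pos _) (F_bounded (ltn0Sn n)).
Qed.

Lemma is_lim_rough_series (N : nat) : is_lim_seq (rough_sum N F) (rough_series N F).
Proof. exact: inv_square_increments_cv (rough_sum_increments N). Qed.

Lemma rough_series_bound (N : nat) : Rabs (rough_series N F) <= 2 * C.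
Proof.
have := inv_square_increments_tail (rough_sum_increments N) 0.
by rewrite /rough_sum big_geq // Rminus_0_r /= Rdiv_1_r.
Qed.

Lemma rough_series_head (N : nat) : (1 < N)%N ->
  Rabs (rough_series N F - F 1%N) <= 2 * C / INR N.
Proof.
case: N => [|[|N]] // _.
have := inv_square_increments_tail (rough_sum_increments N.+2) N.+1.
rewrite {2}/rough_sum big_ltn_cond // rough1 big_nat_cond big1 ?Rplus_0_r // => d.
by case/andP=> dN; rewrite rough_eq1 => [/eqP dE|]; lia.
Qed.

Lemma rough_series_not_prime (N : nat) : ~~ prime N ->
  rough_series N.+1 F = rough_series N F.
Proof.
move=> np; congr real; apply: Lim_seq_ext => M.
by apply: eq_bigl => d; rewrite roughS (negbTE np) andbT.
Qed.

Lemma inv_square_bounded_mull (p : nat) : (0 < p)%N ->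
  inv_square_bounded C (fun d => F (p * d)%N).
Proof.
move=> p0 d d0; apply: Rle_trans (F_bounded _) _; first by rewrite muln_gt0 p0.
have C0 : 0 <= C.
  by have := F_bounded (ltn0Sn 0); rewrite pow1; have := Rabs_pos (F 1%N); lra.
apply: Rmult_le_compat_l => //; apply: Rinv_le_contravar.
  by apply: pow_lt; apply: INR_gt0.
apply: pow_incr; split; first exact: pos_INR.
by apply: le_INR; have := leq_pmull d p0; lia.
Qed.

End RoughSeries.
Arguments is_lim_rough_series {C F}.

Lemma rough_series_unique (N : nat) (F : nat -> R) (l : R) :
  is_lim_seq (rough_sum N F) l -> rough_series N F = l.
Proof. by move=> Fl; rewrite /rough_series (is_lim_seq_unique _ _ Fl). Qed.

Lemma rough_series_prime (C : R) (F : nat -> R) (p : nat) : inv_square_bounded C F ->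
  prime p ->
  rough_series p.+1 F = rough_series p F - rough_series p (fun d => F (p * d)%N).
Proof.
move=> FC pp; have p0 := prime_gt0 pp.
have along_multiples u (l : R) : is_lim_seq u l -> is_lim_seq (fun M => u (p * M)%N) l.
  by apply: is_lim_seq_subseq; apply: eventually_subseq => n; rewrite mulnS; lia.
have lim := along_multiples _ _ (is_lim_rough_series FC p).
have lim_mul := is_lim_rough_series (inv_square_bounded_mull FC p0) p.
have := is_lim_seq_unique _ _ (along_multiples _ _ (is_lim_rough_series FC p.+1)).
rewrite (is_lim_seq_unique _ (rough_series p F - rough_series p (fun d => F (p * d)%N))).
  by case.
apply: is_lim_seq_ext (is_lim_seq_minus' _ _ _ _ lim lim_mul) => M.
by rewrite rough_sum_prime //; ring.
Qed.

Lemma rough_series_lin (C D a : R) (F G : nat -> R) (N : nat) :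
  inv_square_bounded C F -> inv_square_bounded D G ->
  rough_series N (fun d => F d + a * G d) = rough_series N F + a * rough_series N G.
Proof.
move=> FC GD; apply: rough_series_unique.
have lim_aG := is_lim_seq_scal_l _ a (Finite _) (is_lim_rough_series GD N).
apply: is_lim_seq_ext (is_lim_seq_plus' _ _ _ _ (is_lim_rough_series FC N) lim_aG) => M.
by rewrite /rough_sum big_distrr -big_split.
Qed.

Lemma rough_series_scal (C a : R) (F : nat -> R) (N : nat) : inv_square_bounded C F ->
  rough_series N (fun d => a * F d) = a * rough_series N F.
Proof.
move=> FC; apply: rough_series_unique.
apply: is_lim_seq_ext (is_lim_seq_scal_l _ a (Finite _) (is_lim_rough_series FC N)) => M.
by rewrite /rough_sum big_distrr.
Qed.

Lemma eq_rough_series (N : nat) (F G : nat -> R) :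
  (forall d, (0 < d)%N -> F d = G d) -> rough_series N F = rough_series N G.
Proof.
move=> FG; congr real; apply: Lim_seq_ext => M.
rewrite /rough_sum big_nat_cond [RHS]big_nat_cond.
by apply: eq_bigr => d /andP [/andP [d0 _] _]; apply: FG.
Qed.

Section CompletelyMultiplicative.
Variables (C : R) (F : nat -> R).
Hypothesis F_bounded : inv_square_bounded C F.
Hypothesis FM : forall m n, F (m * n)%N = F m * F n.

Lemma rough_series_prime_prod (N : nat) :
  rough_series N F = prime_prod (fun p => 1 - F p) N * rough_series 0 F.
Proof.
elim: N => [|N IH]; first by rewrite /prime_prod big_geq // Rmult_1_l.
rewrite prime_prodS; case: ifP => pN; last first.
  by rewrite (rough_series_not_prime _ (negbT pN)) Rmult_1_r.
have -> : rough_series N.+1 F = rough_series N F - F N * rough_series N F.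
  rewrite (rough_series_prime F_bounded pN) -(rough_series_scal _ _ F_bounded).
  by congr (_ - _); apply: eq_rough_series => d _; rewrite FM.
by rewrite IH; ring.
Qed.

Lemma euler_product_inverse : euler_convergent (fun p => 1 - F p) ->
  euler_product (fun p => 1 - F p) * rough_series 0 F = F 1%N.
Proof.
move=> /is_lim_euler_product lim.
have {}lim := is_lim_seq_scal_r _ (rough_series 0 F) (Finite _) lim.
have lim1 :
    is_lim_seq (fun N => prime_prod (fun p => 1 - F p) N * rough_series 0 F) (F 1%N).
  apply: (is_lim_seq_ext (fun N => rough_series N F)); first exact: rough_series_prime_prod.
  apply/is_lim_seq_spec => eps.
  have [N tail_lt] := eventually_div_INR_lt (2 * C) (cond_pos eps).
  exists N.+2 => n Nn; apply: Rle_lt_trans (rough_series_head F_bounded _) _; first by lia.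
  by apply: tail_lt; lia.
by have := is_lim_seq_unique _ _ lim; rewrite (is_lim_seq_unique _ _ lim1) => -[->].
Qed.

End CompletelyMultiplicative.

(** * The value of [zeta 2] *)

Definition zeta2 : R := rough_series 0 (fun d => / INR d ^ 2).

Definition cos_moment (k m : nat) : R := RInt (fun x => x ^ k * cos x ^ m) 0 (PI / 2).

Lemma PI2_ge0 : 0 <= PI / 2.
Proof. exact: Rlt_le PI2_RGT_0. Qed.

Lemma is_RInt_cos_moment (k m : nat) :
  is_RInt (fun x => x ^ k * cos x ^ m) 0 (PI / 2) (cos_moment k m).
Proof.
apply: RInt_correct; apply: ex_RInt_continuous => x _.
by apply: ex_derive_continuousR; auto_derive.
Qed.
Arguments is_RInt_cos_moment : clear implicits.

Lemma is_derive_sin_cos_pow (m : nat) (x : R) :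
  is_derive (fun x => sin x * cos x ^ m.+1) x
    ((INR m + 2) * cos x ^ m.+2 - (INR m + 1) * cos x ^ m).
Proof.
auto_derive => //; rewrite -/(INR m.+1) S_INR.
have := sin2_cos2 x; rewrite /Rsqr => sc.
rewrite (_ : _ + _ = cos x ^ m.+2 - (INR m + 1) * ((sin x * sin x) * cos x ^ m)) /=.
  by rewrite (_ : sin x * sin x = 1 - cos x * cos x); [ring|lra].
by ring.
Qed.

Lemma cos_moment0_rec (m : nat) :
  (INR m + 2) * cos_moment 0 m.+2 = (INR m + 1) * cos_moment 0 m.
Proof.
apply: Rminus_diag_uniq.
rewrite -(is_RInt_unique _ _ _ _ (is_RInt_Rminus
  (is_RInt_Rscal (INR m + 2) (is_RInt_cos_moment 0 m.+2))
  (is_RInt_Rscal (INR m + 1) (is_RInt_cos_moment 0 m)))).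
apply: is_RInt_unique.
apply: is_RInt_eq (is_RInt_antiderivative PI2_ge0
  (fun x _ => is_derive_sin_cos_pow m x) _); first exact: PI2_ge0.
- by move=> x _; rewrite /=; ring.
- by rewrite cos_PI2 sin_0 /=; ring.
- by move=> x _; apply: ex_derive_continuousR; auto_derive.
Qed.

Lemma cos_moment2_rec (m : nat) :
  2 * cos_moment 0 m.+2 =
  (INR m + 2) * ((INR m + 1) * cos_moment 2 m - (INR m + 2) * cos_moment 2 m.+2).
Proof.
apply: Rminus_diag_uniq.
rewrite -(is_RInt_unique _ _ _ _ (is_RInt_Rminus
  (is_RInt_Rscal 2 (is_RInt_cos_moment 0 m.+2)) (is_RInt_Rscal (INR m + 2) (is_RInt_Rminus
  (is_RInt_Rscal (INR m + 1) (is_RInt_cos_moment 2 m))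
  (is_RInt_Rscal (INR m + 2) (is_RInt_cos_moment 2 m.+2)))))).
apply: is_RInt_unique.
pose dF x := 2 * cos x ^ m.+2
  + (INR m + 2) * (x ^ 2 * ((INR m + 2) * cos x ^ m.+2 - (INR m + 1) * cos x ^ m)).
pose F x := 2 * (x * cos x ^ m.+2) + (INR m + 2) * (x ^ 2 * (sin x * cos x ^ m.+1)).
have DF x : is_derive F x (dF x).
  have D (s : R -> R) (ds : R) : is_derive s x ds ->
      is_derive (fun x => 2 * (x * cos x ^ m.+2) + (INR m + 2) * (x ^ 2 * s x)) x
        (2 * (cos x ^ m.+2 - (INR m + 2) * (x * (sin x * cos x ^ m.+1)))
         + (INR m + 2) * (2 * (x * s x) + x ^ 2 * ds)).
    move=> Ds; auto_derive; first by exists ds.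
    by rewrite (is_derive_unique (fun x => s x) _ _ Ds) -/(INR m.+2) !S_INR /=; ring.
  have -> : dF x = 2 * (cos x ^ m.+2 - (INR m + 2) * (x * (sin x * cos x ^ m.+1)))
      + (INR m + 2) * (2 * (x * (sin x * cos x ^ m.+1))
        + x ^ 2 * ((INR m + 2) * cos x ^ m.+2 - (INR m + 1) * cos x ^ m)).
    by rewrite /dF; ring.
  exact: D (is_derive_sin_cos_pow m x).
apply: is_RInt_eq (is_RInt_antiderivative PI2_ge0 (fun x _ => DF x) _).
- exact: PI2_ge0.
- by move=> x _; rewrite /dF /=; ring.
- by rewrite /F cos_PI2 sin_0 /=; ring.
- by move=> x _; apply: ex_derive_continuousR; rewrite /dF; auto_derive.
Qed.

Lemma cos_moment0_0 : cos_moment 0 0 = PI / 2.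
Proof.
apply: is_RInt_unique; apply: is_RInt_eq (is_RInt_antiderivative (F := id) PI2_ge0 _ _).
- exact: PI2_ge0.
- by move=> x _; apply/esym; rewrite Rmult_1_l.
- exact: Rminus_0_r.
- by move=> x _; apply: is_derive_id.
- by move=> x _; apply: continuous_const.
Qed.

Lemma cos_moment2_0 : cos_moment 2 0 = PI ^ 3 / 24.
Proof.
apply: is_RInt_unique.
apply: is_RInt_eq (is_RInt_antiderivative
  (F := fun x => x ^ 3 / 3) (f := fun x => x ^ 2) PI2_ge0 _ _).
- exact: PI2_ge0.
- by move=> x _; apply/esym; rewrite Rmult_1_r.
- by field.
- by move=> x _; auto_derive => //=; field.
- by move=> x _; apply: ex_derive_continuousR; auto_derive.
Qed.

Lemma cos_moment0_gt0 (n : nat) : 0 < cos_moment 0 (2 * n).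
Proof.
elim: n => [|n IH]; first by rewrite cos_moment0_0; have := PI_RGT_0; lra.
have := cos_moment0_rec (2 * n); have := pos_INR (2 * n).
rewrite (_ : (2 * n.+1 = (2 * n).+2)%N); last by lia.
set m := INR _ => m0 rec; apply: (Rmult_lt_reg_l (m + 2)); first lra.
by rewrite rec Rmult_0_r; apply: Rmult_lt_0_compat; lra.
Qed.

Lemma mul_cos_le_sin (x : R) : 0 <= x <= PI / 2 -> x * cos x <= sin x.
Proof.
move=> [x0 xpi]; have pi0 := PI_RGT_0.
have [t _|t tx] := @mean_value (fun t => sin t - t * cos t) (fun t => t * sin t) 0 x x0.
  by auto_derive => //; ring.
rewrite sin_0 => sin_x; have st : 0 <= sin t by apply: sin_ge_0; lra.
have : 0 <= t * sin t * (x - 0) by apply: Rmult_le_pos; [apply: Rmult_le_pos|]; lra.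
lra.
Qed.

Lemma cos_moment2_bound (n : nat) :
  0 <= cos_moment 2 (2 * n).+2 <= cos_moment 0 (2 * n) - cos_moment 0 (2 * n).+2.
Proof.
have pi0 := PI_RGT_0; set m := (2 * n)%N; split.
  apply: (is_RInt_ge_0 _ _ _ _ PI2_ge0 (is_RInt_cos_moment 2 m.+2)) => x xb.
  by apply: Rmult_le_pos; [apply: pow2_ge_0|apply: pow_le; apply: cos_ge_0; lra].
apply: (is_RInt_le _ _ _ _ _ _ PI2_ge0 (is_RInt_cos_moment 2 m.+2)
  (is_RInt_Rminus (is_RInt_cos_moment 0 m) (is_RInt_cos_moment 0 m.+2))) => x xb.
have c0 : 0 <= cos x by apply: cos_ge_0; lra.
have cs : (x * cos x) ^ 2 <= (sin x) ^ 2.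
  by apply: pow_incr; split; [apply: Rmult_le_pos|apply: mul_cos_le_sin]; lra.
have := sin2_cos2 x; rewrite /Rsqr => sc.
rewrite (_ : x ^ 2 * _ = cos x ^ m * (x * cos x) ^ 2); last by rewrite /=; ring.
rewrite (_ : _ - _ = cos x ^ m * (sin x) ^ 2); last first.
  by rewrite (_ : (sin x) ^ 2 = 1 - cos x * cos x) /=; [ring|lra].
by apply: Rmult_le_compat_l => //; apply: pow_le.
Qed.

(* The increments of [cos_moment 2 (2 n) / cos_moment 0 (2 n)] are [- 1 / (2 (n + 1)^2)]. *)
Lemma rough_sum_zeta2 (n : nat) : rough_sum 0 (fun d => / INR d ^ 2) n =
  PI ^ 2 / 6 - 2 * cos_moment 2 (2 * n) / cos_moment 0 (2 * n).
Proof.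
elim: n => [|n IH].
  rewrite /rough_sum big_geq // muln0 cos_moment0_0 cos_moment2_0; field.
  by have := PI_RGT_0; lra.
rewrite rough_sumS IH (_ : rough 0 n.+1 = true) // S_INR.
rewrite (_ : (2 * n.+1 = (2 * n).+2)%N); last by lia.
have A0 := cos_moment0_gt0 n; have n0 := pos_INR n.
have := cos_moment0_rec (2 * n); have := cos_moment2_rec (2 * n).
have -> : INR (2 * n) = 2 * INR n by rewrite -multE mult_INR.
set A := cos_moment 0 (2 * n) in A0 *; set A' := cos_moment 0 _.+2.
set B := cos_moment 2 (2 * n); set B' := cos_moment 2 _.+2 => rec2 rec0.
have A'E : A' = (2 * INR n + 1) * A / (2 * (INR n + 1)) by field_simplify_eq; lra.
have B'E : B' = ((2 * INR n + 1) * B - 2 * A' / (2 * INR n + 2)) / (2 * INR n + 2).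
  by field_simplify_eq; lra.
by rewrite B'E A'E; field; lra.
Qed.

Lemma cos_moment_ratio_bound (n : nat) :
  0 <= cos_moment 2 (2 * n).+2 / cos_moment 0 (2 * n).+2 <= / INR n.+1.
Proof.
have [B0 B1] := cos_moment2_bound n; have n0 := pos_INR n.
have := cos_moment0_gt0 n.+1; rewrite (_ : (2 * n.+1 = (2 * n).+2)%N); last by lia.
have := cos_moment0_rec (2 * n).
have -> : INR (2 * n) = 2 * INR n by rewrite -multE mult_INR.
rewrite S_INR; set A := cos_moment 0 (2 * n) in B1 *; set A' := cos_moment 0 _.+2 in B1 *.
set B' := cos_moment 2 _.+2 in B0 B1 * => rec A'0.
split; first exact: Rdiv_le_0_compat.
have {rec}AA' : (INR n + 1) * (A - A') = A / 2 by lra.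
have nA' : 0 <= INR n * (A - A') by apply: Rmult_le_pos; lra.
apply/Rle_div_l => //; rewrite Rmult_comm; apply/Rle_div_r; first lra.
have : B' * (INR n + 1) <= (A - A') * (INR n + 1) by apply: Rmult_le_compat_r; lra.
lra.
Qed.

Lemma zeta2E : zeta2 = PI ^ 2 / 6.
Proof.
apply: rough_series_unique; apply/is_lim_seq_incr_1.
apply: (is_lim_seq_ext
  (fun n => PI ^ 2 / 6 - 2 * (cos_moment 2 (2 * n).+2 / cos_moment 0 (2 * n).+2))) => [n|].
  rewrite rough_sum_zeta2 (_ : (2 * n.+1 = (2 * n).+2)%N); last by lia.
  by rewrite /Rdiv Rmult_assoc.
rewrite -[X in is_lim_seq _ (Finite X)]Rminus_0_r.
apply: is_lim_seq_minus'; first exact: is_lim_seq_const.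
apply: (is_lim_seq_le_le (fun=> 0) _ (fun n => 2 / INR n.+1)).
- by move=> n; have := cos_moment_ratio_bound n; rewrite /Rdiv; lra.
- exact: is_lim_seq_const.
- exact/(is_lim_seq_incr_1 (fun n => 2 / INR n))/is_lim_seq_div_INR.
Qed.

(** * The kernel [cos ((2 j + 1) t) / cos t] *)

(* [cos_ratio j t = cos ((2 j + 1) t) / cos t], without a pole at [PI / 2]. *)
Fixpoint cos_ratio (j : nat) (t : R) : R :=
  if j is i.+1 then 2 * cos (2 * INR i.+1 * t) - cos_ratio i t else 1.

Fixpoint cos_ratio_prim (j : nat) (t : R) : R :=
  if j is i.+1 then sin (2 * INR i.+1 * t) / INR i.+1 - cos_ratio_prim i t else t.

Fixpoint cos_ratio_deriv (j : nat) (t : R) : R :=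
  if j is i.+1 then - (4 * INR i.+1 * sin (2 * INR i.+1 * t)) - cos_ratio_deriv i t else 0.

Lemma cos_ratioS (j : nat) (t : R) :
  cos_ratio j.+1 t = 2 * cos (2 * INR j.+1 * t) - cos_ratio j t.
Proof. by []. Qed.

Lemma cos_ratio_primS (j : nat) (t : R) :
  cos_ratio_prim j.+1 t = sin (2 * INR j.+1 * t) / INR j.+1 - cos_ratio_prim j t.
Proof. by []. Qed.

Lemma cos_ratio_derivS (j : nat) (t : R) : cos_ratio_deriv j.+1 t =
  - (4 * INR j.+1 * sin (2 * INR j.+1 * t)) - cos_ratio_deriv j t.
Proof. by []. Qed.

Lemma cos_ratio_mul_cos (j : nat) (t : R) :
  cos_ratio j t * cos t = cos ((2 * INR j + 1) * t).
Proof.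
elim: j => [|j IH]; first by rewrite /= Rmult_1_l; congr cos; ring.
rewrite cos_ratioS Rmult_minus_distr_r IH S_INR.
set a := 2 * (INR j + 1) * t.
have -> : (2 * INR j + 1) * t = a - t by rewrite /a; ring.
have -> : (2 * (INR j + 1) + 1) * t = a + t by rewrite /a; ring.
by rewrite cos_plus cos_minus; ring.
Qed.

Lemma is_derive_cos_ratio_prim (j : nat) (t : R) :
  is_derive (cos_ratio_prim j) t (cos_ratio j t).
Proof.
elim: j => [|j IH]; first exact: is_derive_id.
have j1 := INR_gt0 (ltn0Sn j).
apply: (is_derive_ext (fun t => sin (2 * INR j.+1 * t) / INR j.+1 - cos_ratio_prim j t)).
  by move=> x; rewrite cos_ratio_primS.
rewrite cos_ratioS; apply: is_derive_minus => //.
by move: (INR j.+1) j1 => n n0; auto_derive => //; field; lra.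
Qed.

Lemma is_derive_cos_ratio (j : nat) (t : R) :
  is_derive (cos_ratio j) t (cos_ratio_deriv j t).
Proof.
elim: j => [|j IH]; first exact: is_derive_const.
apply: (is_derive_ext (fun t => 2 * cos (2 * INR j.+1 * t) - cos_ratio j t)) => //.
rewrite cos_ratio_derivS; apply: is_derive_minus => //.
by move: (INR j.+1) => n; auto_derive => //; ring.
Qed.

Lemma continuous_cos_ratio (j : nat) (t : R) : continuous (cos_ratio j) t.
Proof. exact: is_derive_continuous (is_derive_cos_ratio j t). Qed.

Lemma continuous_cos_ratio_deriv (j : nat) (t : R) : continuous (cos_ratio_deriv j) t.
Proof.
elim: j => [|j IH]; first exact: continuous_const.
apply: (continuous_minus (fun t => - (4 * INR j.+1 * sin (2 * INR j.+1 * t)))) => //.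
by apply: ex_derive_continuousR; auto_derive.
Qed.

Lemma cos_ratio_bounded (j : nat) : exists2 C, 0 < C &
  forall t, Rabs (cos_ratio j t) <= C /\ Rabs (cos_ratio_deriv j t) <= C.
Proof.
elim: j => [|j [C C0 IH]].
  by exists 1; [lra|move=> t /=; rewrite Rabs_R1 Rabs_R0; lra].
have j1 := INR_gt0 (ltn0Sn j).
exists (C + 4 * INR j.+1 + 2) => [|t]; first lra.
have [/Rabs_le_between q_le /Rabs_le_between dq_le] := IH t.
rewrite cos_ratioS cos_ratio_derivS.
have := COS_bound (2 * INR j.+1 * t); have := SIN_bound (2 * INR j.+1 * t).
set a := cos _; set b := sin _ => b1 a1.
by split; apply/Rabs_le_between; nra.
Qed.

Lemma cos_ratio_prim0 (j : nat) : cos_ratio_prim j 0 = 0.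
Proof. by elim: j => // j IH; rewrite /= IH Rmult_0_r sin_0; lra. Qed.

Lemma sin_nat_PI (n : nat) : sin (INR n * PI) = 0.
Proof. by apply: sin_eq_0_1; exists (Z.of_nat n); rewrite -INR_IZR_INZ. Qed.

Lemma cos_ratio_prim_PI2 (j : nat) : cos_ratio_prim j (PI / 2) = (- 1) ^ j * (PI / 2).
Proof.
elim: j => [|j IH]; first by rewrite /=; ring.
rewrite cos_ratio_primS IH.
have -> : 2 * INR j.+1 * (PI / 2) = INR j.+1 * PI by field.
have j1 := INR_gt0 (ltn0Sn j).
by rewrite sin_nat_PI -tech_pow_Rmult; field; lra.
Qed.

Lemma sin_odd_PI2 (j : nat) : sin ((2 * INR j + 1) * (PI / 2)) = (- 1) ^ j.
Proof.
elim: j => [|j IH]; first by rewrite /= Rmult_0_r Rplus_0_l Rmult_1_l sin_PI2.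
rewrite S_INR (_ : _ * _ = (2 * INR j + 1) * (PI / 2) + PI); last by field.
by rewrite neg_sin IH /=; ring.
Qed.

Lemma is_RInt_cos_ratio (j : nat) (x : R) : 0 <= x ->
  is_RInt (cos_ratio j) 0 x (cos_ratio_prim j x).
Proof.
move=> x0; rewrite -[X in is_RInt _ _ _ X]Rminus_0_r -{2}(cos_ratio_prim0 j).
apply: is_RInt_antiderivative => // t _.
  exact: is_derive_cos_ratio_prim.
exact: continuous_cos_ratio.
Qed.

Lemma is_RInt_cos_ratio_cos (j : nat) (x : R) : 0 <= x ->
  is_RInt (fun t => cos_ratio j t * cos t) 0 x
    (sin ((2 * INR j + 1) * x) / (2 * INR j + 1)).
Proof.
move=> x0; have j0 := pos_INR j; set n := 2 * INR j + 1.
apply: (is_RInt_eq (f := fun t => cos (n * t)) x0 _ _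
  (is_RInt_antiderivative (F := fun t => sin (n * t) / n) x0 _ _)) => [t _||t _|t _].
- by rewrite cos_ratio_mul_cos.
- by rewrite Rmult_0_r sin_0; rewrite /n; field; lra.
- by auto_derive => //; field; rewrite /n; lra.
- by apply: ex_derive_continuousR; auto_derive.
Qed.

Lemma is_RInt_cos_ratio_cos2 (j : nat) : (0 < j)%N ->
  is_RInt (fun t => cos_ratio j t * cos t ^ 2) 0 (PI / 2) 0.
Proof.
move=> /INR_gt0 j0.
pose F t := sin (2 * INR j * t) / (4 * INR j) + sin (2 * INR j.+1 * t) / (4 * INR j.+1).
pose f t := (cos (2 * INR j * t) + cos (2 * INR j.+1 * t)) / 2.
apply: (is_RInt_eq (f := f) PI2_ge0 _ _ (is_RInt_antiderivative (F := F) PI2_ge0 _ _))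
  => [t _||t _|t _].
- rewrite (_ : _ * cos t ^ 2 = (cos_ratio j t * cos t) * cos t); last by ring.
  rewrite cos_ratio_mul_cos; set a := (2 * INR j + 1) * t.
  rewrite /f S_INR (_ : 2 * INR j * t = a - t); last by rewrite /a; ring.
  rewrite (_ : 2 * (INR j + 1) * t = a + t); last by rewrite /a; ring.
  by rewrite cos_plus cos_minus; field.
- rewrite /F !Rmult_0_r sin_0.
  have -> : 2 * INR j * (PI / 2) = INR j * PI by field.
  have -> : 2 * INR j.+1 * (PI / 2) = INR j.+1 * PI by field.
  by rewrite !sin_nat_PI S_INR; field; lra.
- by rewrite /F /f S_INR; auto_derive => //; field; lra.
- by rewrite /f; apply: ex_derive_continuousR; auto_derive.
Qed.

(** * The angle [arcsec] and the ramp integrals *)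

(* Since [sqrt] vanishes on negative numbers, this is [0] for [0 <= z <= 1]. *)
Definition arcsec (z : R) : R := atan (sqrt (z ^ 2 - 1)).

Lemma arcsec_le1 (z : R) : 0 <= z <= 1 -> arcsec z = 0.
Proof. by move=> z1; rewrite /arcsec sqrt_neg_0 ?atan_0 //; nra. Qed.

Lemma arcsec_bound (z : R) : 0 <= arcsec z <= PI / 2.
Proof.
have [_ lt_PI2] := atan_bound (sqrt (z ^ 2 - 1)); rewrite /arcsec; split; last lra.
have [s0|<-] := sqrt_pos (z ^ 2 - 1); last by rewrite atan_0; lra.
by left; rewrite -[X in X < _]atan_0; apply: atan_increasing.
Qed.

Lemma cos_arcsec (z : R) : 1 <= z -> cos (arcsec z) = / z.
Proof.
move=> z1; rewrite cos_atan Rsqr_sqrt; last nra.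
by rewrite (_ : 1 + _ = z ^ 2); [rewrite sqrt_pow2; [field|]; lra|ring].
Qed.

Lemma sin_arcsec (z : R) : 1 <= z -> sin (arcsec z) = sqrt (z ^ 2 - 1) / z.
Proof.
move=> z1; rewrite sin_atan Rsqr_sqrt; last nra.
by rewrite (_ : 1 + _ = z ^ 2); [rewrite sqrt_pow2 //; lra|ring].
Qed.

Lemma continuous_arcsec (z : R) : continuous arcsec z.
Proof.
apply: continuous_atan_comp; apply: (continuous_comp (fun z => z ^ 2 - 1)).
  by apply: ex_derive_continuousR; auto_derive.
exact: continuous_sqrt.
Qed.

Lemma is_derive_arcsec (z : R) : 1 < z -> is_derive arcsec z (/ (z * sqrt (z ^ 2 - 1))).
Proof.
move=> z1; have s0 : 0 < sqrt (z ^ 2 - 1) by apply: sqrt_lt_R0; nra.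
rewrite /arcsec; auto_derive; first nra.
have -> : z * (z * 1) + - (1) = z ^ 2 - 1 by ring.
rewrite [X in / (1 + X)](_ : _ = sqrt (z ^ 2 - 1) * sqrt (z ^ 2 - 1)); last by ring.
by rewrite sqrt_sqrt; [field|]; nra.
Qed.

(* The integral of [cos_ratio j t * max 0 (z * cos t - 1)] over [[0, PI / 2]]. *)
Definition ramp_moment (j : nat) (z : R) : R :=
  z * sin ((2 * INR j + 1) * arcsec z) / (2 * INR j + 1) - cos_ratio_prim j (arcsec z).

Definition ramp_moment_deriv (j : nat) (z : R) : R :=
  sin ((2 * INR j + 1) * arcsec z) / (2 * INR j + 1).

Lemma ramp_moment_le1 (j : nat) (z : R) : 0 <= z <= 1 -> ramp_moment j z = 0.
Proof.
move=> z1; have j0 := pos_INR j.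
by rewrite /ramp_moment arcsec_le1 // Rmult_0_r sin_0 cos_ratio_prim0; field; lra.
Qed.

Lemma ramp_moment_deriv_le1 (j : nat) (z : R) : 0 <= z <= 1 -> ramp_moment_deriv j z = 0.
Proof.
move=> z1; have j0 := pos_INR j.
by rewrite /ramp_moment_deriv arcsec_le1 // Rmult_0_r sin_0; field; lra.
Qed.

Lemma continuous_ramp_moment_deriv (j : nat) (z : R) : continuous (ramp_moment_deriv j) z.
Proof.
apply: (continuous_comp arcsec (fun t => sin ((2 * INR j + 1) * t) / (2 * INR j + 1))).
  exact: continuous_arcsec.
by apply: ex_derive_continuousR; auto_derive.
Qed.

Lemma continuous_ramp_moment (j : nat) (z : R) : continuous (ramp_moment j) z.
Proof.
apply: (continuous_ext (fun z => z * ramp_moment_deriv j z - cos_ratio_prim j (arcsec z))).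
  by move=> x; rewrite /ramp_moment /ramp_moment_deriv /Rdiv Rmult_assoc.
apply: (continuous_minus (fun z => z * ramp_moment_deriv j z)).
  apply: (continuous_mult id); first exact: continuous_id.
  exact: continuous_ramp_moment_deriv.
apply: (continuous_comp arcsec); first exact: continuous_arcsec.
exact: is_derive_continuous (is_derive_cos_ratio_prim j _).
Qed.

(* The derivative of [arcsec] drops out, because
   [z * cos ((2 j + 1) * arcsec z) = cos_ratio j (arcsec z)]. *)
Lemma is_derive_ramp_moment_gt1 (j : nat) (z : R) : 1 < z ->
  is_derive (ramp_moment j) z (ramp_moment_deriv j z).
Proof.
move=> z1; have j0 := pos_INR j; have Dphi := is_derive_arcsec z1.
have s0 : 0 < sqrt (z ^ 2 - 1) by apply: sqrt_lt_R0; nra.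
rewrite /ramp_moment; auto_derive.
  have ex_arcsec : ex_derive arcsec z by exists (/ (z * sqrt (z ^ 2 - 1))).
  do 2![split=> //].
  by exists (cos_ratio j (arcsec z)); apply: is_derive_cos_ratio_prim.
rewrite (is_derive_unique (fun x => arcsec x) _ _ Dphi).
rewrite (is_derive_unique (fun t => cos_ratio_prim j t) _ _ (is_derive_cos_ratio_prim j _)).
rewrite -cos_ratio_mul_cos cos_arcsec /ramp_moment_deriv; last lra.
by field; lra.
Qed.

Lemma is_derive_ramp_moment (j : nat) (z : R) : 0 < z ->
  is_derive (ramp_moment j) z (ramp_moment_deriv j z).
Proof.
move=> z0.
have lt1 x : 0 < x < 1 -> is_derive (ramp_moment j) x (ramp_moment_deriv j x).
  move=> [x0 x1]; rewrite ramp_moment_deriv_le1; last lra.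
  apply: (is_derive_ext_loc (fun=> 0)); last exact: is_derive_const.
  apply: (locally_interval _ x 0 1) => [||y y0 y1] /=; try lra.
  by rewrite ramp_moment_le1 //; move: y0 y1 => /=; lra.
have [zlt1|[->|]] := Rtotal_order z 1; [exact: lt1| |exact: is_derive_ramp_moment_gt1].
apply: is_derive_punctured.
- exact: continuous_ramp_moment.
- exact: continuous_ramp_moment_deriv.
apply: (locally_interval _ 1 0 2) => /=; try lra; move=> x x0 x2 x1.
by have [?|[//|?]] := Rtotal_order x 1; [apply: lt1|apply: is_derive_ramp_moment_gt1].
Qed.

Lemma is_RInt_cos_ratio_linear (j : nat) (N m x : R) : 0 <= x ->
  is_RInt (fun t => cos_ratio j t * (N * cos t - m)) 0 x
    (N * (sin ((2 * INR j + 1) * x) / (2 * INR j + 1)) - m * cos_ratio_prim j x).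
Proof.
move=> x0; apply: is_RInt_eq (is_RInt_Rminus (is_RInt_Rscal N (is_RInt_cos_ratio_cos x0))
  (is_RInt_Rscal m (is_RInt_cos_ratio x0))) => // t _.
by ring.
Qed.

Lemma is_RInt_cos_ratio_ramp (j : nat) (N m : R) : 0 < N -> 0 < m ->
  is_RInt (fun t => cos_ratio j t * Rmax 0 (N * cos t - m)) 0 (PI / 2)
    (m * ramp_moment j (N / m)).
Proof.
move=> N0 m0; have j0 := pos_INR j; have [phi0 phi_PI2] := arcsec_bound (N / m).
set phi := arcsec (N / m) in phi0 phi_PI2 *.
have z0 : 0 <= N / m by apply: Rdiv_le_0_compat; lra.
have pos_part t : 0 < t < phi -> 0 <= N * cos t - m.
  move=> tb; have z1 : 1 < N / m.
    by apply: Rnot_le_lt => z1; move: tb; rewrite /phi arcsec_le1 //; lra.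
  have : cos phi <= cos t by apply: cos_decr_1; lra.
  rewrite cos_arcsec; last lra.
  by rewrite Rinv_div => /Rle_div_l; rewrite Rmult_comm; lra.
have neg_part t : 0 <= t <= PI / 2 -> phi <= t -> N * cos t - m <= 0.
  move=> tb tphi; have [z1|z1] := Rle_lt_dec (N / m) 1.
    by have [_ c1] := COS_bound t; move/Rle_div_l: z1; nra.
  have : cos t <= cos phi by apply: cos_decr_1; lra.
  rewrite cos_arcsec; last lra.
  by rewrite Rinv_div => /Rle_div_r; rewrite Rmult_comm; lra.
have low : is_RInt (fun t => cos_ratio j t * Rmax 0 (N * cos t - m)) 0 phi
    (m * ramp_moment j (N / m)).
  apply: is_RInt_eq (is_RInt_cos_ratio_linear (N := N) (m := m) phi0) => // [t tb|].
    by rewrite Rmax_right //; apply: pos_part.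
  by rewrite /ramp_moment -/phi; field; lra.
have high : is_RInt (fun t => cos_ratio j t * Rmax 0 (N * cos t - m)) phi (PI / 2) 0.
  apply: is_RInt_eq (is_RInt_zero phi (PI / 2)) => // t tb.
  by rewrite Rmax_left ?Rmult_0_r //; apply: neg_part; lra.
rewrite -(Rplus_0_r (m * _)); exact: (is_RInt_Chasles _ _ _ _ _ _ low high).
Qed.

(** * The periodic parabola and its moments *)

(* [1 / 12 - frac_parabola] is half the periodic second Bernoulli polynomial. *)
Definition frac_parabola (x : R) : R := frac_part x * (1 - frac_part x) / 2.

Lemma frac_parabolaE (i : Z) (x : R) : IZR i <= x <= IZR i + 1 ->
  frac_parabola x = (x - IZR i) * (IZR i + 1 - x) / 2.
Proof.
have frac_partE (k : Z) : IZR k <= x < IZR k + 1 -> frac_part x = x - IZR k.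
  by move=> xk; rewrite /frac_part -(Int_part_spec x k) //; lra.
move=> xi; have [ix|xi1] := Rle_lt_dec (IZR i + 1) x.
  rewrite /frac_parabola (frac_partE (i + 1)%Z) plus_IZR; last lra.
  by have -> : x = IZR i + 1; [lra|field].
by rewrite /frac_parabola (frac_partE i); [field|lra].
Qed.

Lemma frac_parabola0 : frac_parabola 0 = 0.
Proof. by rewrite (frac_parabolaE (i := 0)); lra. Qed.

Lemma frac_parabola_add1 (x : R) : frac_parabola (x + 1) = frac_parabola x.
Proof.
have [i xi] := floor_ex x.
rewrite (frac_parabolaE (i := i) (x := x)) ?(frac_parabolaE (i := (i + 1)%Z)) ?plus_IZR //.
all: lra.
Qed.

Lemma frac_parabola_bound (x : R) : 0 <= frac_parabola x <= 1 / 8.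
Proof.
by have := base_fp x; rewrite /frac_parabola; have := pow2_ge_0 (frac_part x - 1 / 2); nra.
Qed.

Lemma frac_parabola_lipschitz : lipschitz (1 / 2) frac_parabola.
Proof.
move=> x y; wlog xy : x y / x <= y => [sym|].
  have [xy|yx] := Rle_lt_dec x y; first exact: sym.
  by rewrite Rabs_minus_sym (Rabs_minus_sym x); apply: sym; lra.
rewrite (Rabs_left1 (x - y)); last lra.
have [i xi] := floor_ex x; have [k yk] := floor_ex y.
rewrite (frac_parabolaE (i := i) (x := x)) ?(frac_parabolaE (i := k) (x := y)); try lra.
have [ik|ki] := Z.lt_ge_cases i k.
  have {}ik : IZR i + 1 <= IZR k by rewrite -plus_IZR; apply: IZR_le; lia.
  by apply/Rabs_le_between; nra.
have {ki} ik : i = k.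
  by have : (i < k + 1)%Z; [apply: lt_IZR; rewrite plus_IZR; lra|lia].
subst k; rewrite (_ : _ - _ = (x - y) * (1 - (x - IZR i) - (y - IZR i)) / 2); last by field.
by apply/Rabs_le_between; split; nra.
Qed.

Lemma sum_ramp (M : nat) (x : R) : 0 <= x <= INR M ->
  \big[Rplus/0]_(1 <= m < M.+1) Rmax 0 (x - INR m) = x ^ 2 / 2 - x / 2 + frac_parabola x.
Proof.
elim: M x => [|M IH] x.
  by rewrite [INR 0]/= => x0; rewrite big_geq // (_ : x = 0) ?frac_parabola0; lra.
rewrite S_INR => xM; have [x1|x1] := Rlt_le_dec x 1.
  rewrite big_nat big1 => [|m /andP [/INR_ge1 m1 _]]; last by rewrite Rmax_left; lra.
  by rewrite (frac_parabolaE (i := 0)); lra.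
rewrite big_nat_recl // [INR 1]/= (_ : frac_parabola x = frac_parabola (x - 1)); last first.
  by rewrite -[RHS]frac_parabola_add1; congr frac_parabola; ring.
rewrite Rmax_right; last lra.
rewrite (eq_bigr (fun m => Rmax 0 (x - 1 - INR m))) => [|m _]; last first.
  by rewrite S_INR; congr Rmax; ring.
by rewrite IH; [field|lra].
Qed.

Definition centered_parabola (x : R) : R := frac_parabola x - 1 / 12.

Definition centered_parabola_prim (x : R) : R := RInt centered_parabola 0 x.

Lemma continuous_centered_parabola (x : R) : continuous centered_parabola x.
Proof.
apply: (continuous_minus frac_parabola); last exact: continuous_const.
exact: lipschitz_continuous frac_parabola_lipschitz.
Qed.

Lemma centered_parabola_bound (x : R) : Rabs (centered_parabola x) <= 1.
Proof.
have := frac_parabola_bound x; rewrite /centered_parabola => b.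
by apply/Rabs_le_between; lra.
Qed.

Lemma ex_RInt_centered_parabola (a b : R) : ex_RInt centered_parabola a b.
Proof. by apply: ex_RInt_continuous => x _; apply: continuous_centered_parabola. Qed.

Lemma is_derive_centered_parabola_prim (x : R) :
  is_derive centered_parabola_prim x (centered_parabola x).
Proof.
apply: (is_derive_RInt centered_parabola _ 0); last exact: continuous_centered_parabola.
by apply: filter_forall => b; apply: RInt_correct; apply: ex_RInt_centered_parabola.
Qed.

Lemma centered_parabola_prim_nat (n : nat) : centered_parabola_prim (INR n) = 0.
Proof.
elim: n => [|n IH]; first by rewrite /centered_parabola_prim RInt_point.
rewrite /centered_parabola_prim -(RInt_Chasles _ 0 (INR n)).
2,3: exact: ex_RInt_centered_parabola.
rewrite -/(centered_parabola_prim (INR n)) IH plus_zero_l S_INR; apply: is_RInt_unique.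
set a := INR n.
pose F x := (x - a) ^ 2 / 4 - (x - a) ^ 3 / 6 - (x - a) / 12.
pose f x := (x - a) * (a + 1 - x) / 2 - 1 / 12.
have a1 : a <= a + 1 by lra.
apply: (is_RInt_eq (f := f) a1 _ _ (is_RInt_antiderivative (F := F) a1 _ _))
  => [x xa||x _|x _].
- by rewrite /centered_parabola (frac_parabolaE (i := Z.of_nat n)) -INR_IZR_INZ -/a //; lra.
- by rewrite /F; field.
- by rewrite /F /f; auto_derive => //; field.
- by rewrite /f; apply: ex_derive_continuousR; auto_derive.
Qed.

Lemma centered_parabola_prim_bound (x : R) : 0 <= x -> Rabs (centered_parabola_prim x) <= 1.
Proof.
move=> x0; have [n nx] := nfloor_ex x x0.
rewrite /centered_parabola_prim -(RInt_Chasles _ 0 (INR n)).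
2,3: exact: ex_RInt_centered_parabola.
rewrite -/(centered_parabola_prim (INR n)) centered_parabola_prim_nat plus_zero_l.
apply: Rle_trans (_ : (x - INR n) * 1 <= 1); last lra.
apply: abs_RInt_le_const => [||y _]; first lra.
  exact: ex_RInt_centered_parabola.
exact: centered_parabola_bound.
Qed.

Definition parabola_moment (j : nat) (N : R) : R :=
  RInt (fun t => cos_ratio j t * frac_parabola (N * cos t)) 0 (PI / 2).

Lemma continuous_mul_cos (N t : R) : continuous (fun t => N * cos t) t.
Proof. by apply: ex_derive_continuousR; auto_derive. Qed.

Lemma is_RInt_parabola_moment (j : nat) (N : R) :
  is_RInt (fun t => cos_ratio j t * frac_parabola (N * cos t)) 0 (PI / 2)
    (parabola_moment j N).
Proof.
apply: RInt_correct; apply: ex_RInt_continuous => t _.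
apply: (continuous_mult (cos_ratio j)); first exact: continuous_cos_ratio.
apply: (continuous_comp (fun t => N * cos t)); first exact: continuous_mul_cos.
exact: lipschitz_continuous frac_parabola_lipschitz.
Qed.
Arguments is_RInt_parabola_moment : clear implicits.

Lemma parabola_moment0 (j : nat) : parabola_moment j 0 = 0.
Proof.
apply: is_RInt_unique; apply: is_RInt_ext (is_RInt_zero _ _) => t _.
by rewrite Rmult_0_l frac_parabola0 Rmult_0_r.
Qed.

Definition linear_coef (j : nat) : R := (- 1) ^ j / (2 * INR j + 1) / 2.

Lemma parabola_moment_sum (j M : nat) (N : R) : (0 < j)%N -> 0 < N <= INR M ->
  parabola_moment j N = \big[Rplus/0]_(1 <= m < M.+1) (INR m * ramp_moment j (N / INR m))
    + linear_coef j * N.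
Proof.
move=> j0 [N0 NM]; apply: is_RInt_unique; have j_ge0 := pos_INR j.
have ramps : is_RInt (fun t => \big[Rplus/0]_(1 <= m < M.+1)
      (cos_ratio j t * Rmax 0 (N * cos t - INR m))) 0 (PI / 2)
    (\big[Rplus/0]_(1 <= m < M.+1) (INR m * ramp_moment j (N / INR m))).
  apply: is_RInt_big_nat => m /andP [/INR_gt0 m0 _].
  exact: is_RInt_cos_ratio_ramp.
apply: is_RInt_eq (is_RInt_Rplus ramps (is_RInt_Rplus
  (is_RInt_Rscal (- N ^ 2 / 2) (is_RInt_cos_ratio_cos2 j0))
  (is_RInt_Rscal (N / 2) (is_RInt_cos_ratio_cos (j := j) PI2_ge0)))); first exact: PI2_ge0.
- move=> t tb; rewrite -big_distrr /= sum_ramp; first by field.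
  have c0 : 0 <= cos t by apply: cos_ge_0; lra.
  by have [_ c1] := COS_bound t; split; nra.
- by rewrite sin_odd_PI2 /linear_coef; field; lra.
Qed.

Lemma parabola_moment_lipschitz (j : nat) :
  exists2 C, 0 < C & lipschitz C (parabola_moment j).
Proof.
have [C C0 qC] := cos_ratio_bounded j; have pi0 := PI_RGT_0.
exists (PI / 2 * C) => [|x y]; first nra.
have Idiff := is_RInt_Rminus (is_RInt_parabola_moment j x) (is_RInt_parabola_moment j y).
rewrite -(is_RInt_unique _ _ _ _ Idiff).
apply: Rle_trans (_ : (PI / 2 - 0) * (C * Rabs (x - y)) <= _); last by right; ring.
apply: abs_RInt_le_const => [||t _]; [exact: PI2_ge0|by eexists; exact: Idiff|].
rewrite -Rmult_minus_distr_l Rabs_mult; apply: Rmult_le_compat; try exact: Rabs_pos.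
  by case: (qC t).
apply: Rle_trans (frac_parabola_lipschitz _ _) _.
rewrite -Rmult_minus_distr_r Rabs_mult.
have : Rabs (cos t) <= 1 by apply/Rabs_le_between; apply: COS_bound.
by have := Rabs_pos (x - y); have := Rabs_pos (cos t); nra.
Qed.

(** * Integrals with an oscillating function of [N * cos t] *)

Lemma sin_ge_half (x : R) : 0 <= x <= 1 -> x / 2 <= sin x.
Proof.
move=> xb; have pi3 := PI2_3_2; have := @mul_cos_le_sin x ltac:(lra).
have : / 2 <= cos x.
  by rewrite (_ : / 2 = cos (PI / 3)); [apply: cos_decr_1; lra|rewrite cos_PI3; lra].
nra.
Qed.

Lemma is_RInt_inv_sin_sqr (d : R) : 0 < d <= PI / 2 ->
  is_RInt (fun t => / sin t ^ 2) d (PI / 2) (cos d / sin d).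
Proof.
move=> [d0 dpi].
have s0 t : d <= t <= PI / 2 -> 0 < sin t by move=> tb; apply: sin_gt_0; lra.
apply: (is_RInt_eq dpi _ _
  (is_RInt_antiderivative (F := fun t => - (cos t / sin t)) dpi _ _))
  => [t _||t /s0 st|t /s0 st].
- by [].
- by rewrite cos_PI2 sin_PI2; field; have := s0 d; lra.
- auto_derive; first lra.
  have := sin2_cos2 t; rewrite /Rsqr => sc.
  transitivity ((sin t * sin t + cos t * cos t) / (sin t * sin t) : R); first by field; lra.
  by rewrite sc; field; lra.
- by apply: ex_derive_continuousR; auto_derive; nra.
Qed.

(* Integration by parts away from the stationary point [t = 0], at distance
   [1 / sqrt N] from it. *)
Section CosinePhase.
Variables (q dq w W : R -> R) (C : R).
Hypothesis Dq : forall t, is_derive q t (dq t).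
Hypothesis continuous_dq : forall t, continuous dq t.
Hypothesis q_bound : forall t, Rabs (q t) <= C.
Hypothesis dq_bound : forall t, Rabs (dq t) <= C.
Hypothesis DW : forall x, is_derive W x (w x).
Hypothesis continuous_w : forall x, continuous w x.
Hypothesis w_bound : forall x, Rabs (w x) <= 1.
Hypothesis W_bound : forall x, 0 <= x -> Rabs (W x) <= 1.

Variable N : R.
Hypothesis N1 : 1 <= N.

Definition phase_boundary (t : R) : R := q t * W (N * cos t) / sin t.

Definition phase_remainder (t : R) : R :=
  (dq t / sin t - q t * cos t / sin t ^ 2) * W (N * cos t).

Lemma is_derive_phase_boundary (t : R) : 0 < sin t ->
  is_derive phase_boundary t (phase_remainder t - N * (q t * w (N * cos t))).
Proof.
move=> st; rewrite /phase_boundary; auto_derive.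
  split; first by exists (dq t).
  by split; [exists (w (N * cos t))|split; lra].
rewrite (is_derive_unique (fun x => q x) _ _ (Dq t)).
rewrite (is_derive_unique (fun x => W x) _ _ (DW (N * cos t))).
by rewrite /phase_remainder; field; lra.
Qed.

Lemma continuous_phase_integrand (t : R) : continuous (fun t => q t * w (N * cos t)) t.
Proof.
apply: (continuous_mult q); first exact: is_derive_continuous (Dq t).
by apply: (continuous_comp (fun t => N * cos t)); [exact: continuous_mul_cos|].
Qed.

Lemma ex_RInt_phase_integrand (a b : R) : ex_RInt (fun t => q t * w (N * cos t)) a b.
Proof. by apply: ex_RInt_continuous => t _; apply: continuous_phase_integrand. Qed.

Lemma continuous_phase_remainder (t : R) : 0 < sin t -> continuous phase_remainder t.
Proof.
move=> st; apply: (continuous_mult (fun t => _ - _)); last first.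
  apply: (continuous_comp (fun t => N * cos t)); first exact: continuous_mul_cos.
  exact: is_derive_continuous (DW _).
apply: (continuous_minus (fun t => dq t * / sin t)).
  apply: (continuous_mult dq); first exact: continuous_dq.
  by apply: ex_derive_continuousR; auto_derive; lra.
apply: (continuous_ext (fun t => q t * (cos t / sin t ^ 2))).
  by move=> x; rewrite /Rdiv Rmult_assoc.
apply: (continuous_mult q); first exact: is_derive_continuous (Dq t).
by apply: ex_derive_continuousR; auto_derive; nra.
Qed.

Lemma phase_boundary_bound (t : R) : 0 < t <= PI / 2 ->
  Rabs (phase_boundary t) <= C / sin t.
Proof.
move=> tb; have st : 0 < sin t by apply: sin_gt_0; lra.
rewrite /phase_boundary /Rdiv Rabs_mult Rabs_inv (Rabs_right (sin t)); last lra.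
apply: Rmult_le_compat_r; first by left; apply: Rinv_0_lt_compat.
rewrite Rabs_mult -(Rmult_1_r C); apply: Rmult_le_compat; try exact: Rabs_pos => //.
  exact: q_bound.
by apply: W_bound; apply: Rmult_le_pos; [lra|apply: cos_ge_0; lra].
Qed.

Lemma phase_remainder_bound (t : R) : 0 < t <= PI / 2 ->
  Rabs (phase_remainder t) <= 2 * C * / sin t ^ 2.
Proof.
move=> tb; have st : 0 < sin t by apply: sin_gt_0; lra.
have i1 : 1 <= / sin t by rewrite -Rinv_1; apply: Rinv_le_contravar; [|case: (SIN_bound t)].
have W1 : Rabs (W (N * cos t)) <= 1.
  by apply: W_bound; apply: Rmult_le_pos; [lra|apply: cos_ge_0; lra].
have c1 : Rabs (cos t) <= 1 by apply/Rabs_le_between; apply: COS_bound.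
rewrite /phase_remainder Rabs_mult -(Rmult_1_r (2 * C * _)).
apply: Rmult_le_compat => //; try exact: Rabs_pos.
rewrite /Rdiv -!pow_inv; set i := / sin t in i1 *.
apply: Rle_trans (Rabs_triang _ _) _.
rewrite Rabs_Ropp (Rabs_mult (dq t)) (Rabs_mult _ (i ^ 2)) (Rabs_mult (q t)).
rewrite (Rabs_right i) ?(Rabs_right (i ^ 2)); try nra.
have C0 : 0 <= C by apply: Rle_trans (Rabs_pos _) (q_bound 0).
have -> : 2 * C * i ^ 2 = C * i ^ 2 + C * 1 * i ^ 2 by ring.
have i2 : i <= i ^ 2 by nra.
apply: Rplus_le_compat; first by apply: Rmult_le_compat => //; [exact: Rabs_pos|lra].
apply: Rmult_le_compat_r; first lra.
by apply: Rmult_le_compat => //; exact: Rabs_pos.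
Qed.

Lemma is_RInt_phase_parts (d : R) : 0 < d <= PI / 2 ->
  is_RInt (fun t => phase_remainder t - N * (q t * w (N * cos t))) d (PI / 2)
    (phase_boundary (PI / 2) - phase_boundary d).
Proof.
move=> [d0 dpi]; apply: is_RInt_antiderivative => // t tb.
  by apply: is_derive_phase_boundary; apply: sin_gt_0; lra.
apply: (continuous_minus phase_remainder).
  by apply: continuous_phase_remainder; apply: sin_gt_0; lra.
apply: (continuous_mult (fun=> N)); first exact: continuous_const.
exact: continuous_phase_integrand.
Qed.

Lemma phase_integral_away (d : R) : 0 < d <= PI / 2 ->
  Rabs (RInt (fun t => q t * w (N * cos t)) d (PI / 2)) <= 4 * C / (N * sin d).
Proof.
move=> db; have [d0 dpi] := db; have sd : 0 < sin d by apply: sin_gt_0; lra.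
have C0 : 0 <= C by apply: Rle_trans (Rabs_pos _) (q_bound 0).
have IJ := RInt_correct _ _ _ (ex_RInt_phase_integrand d (PI / 2)).
set J := RInt _ _ _ in IJ *.
have Ir := is_RInt_Rplus (is_RInt_phase_parts db) (is_RInt_Rscal N IJ).
have {}Ir : is_RInt phase_remainder d (PI / 2)
    (phase_boundary (PI / 2) - phase_boundary d + N * J).
  by apply: is_RInt_eq Ir => // t _; ring.
have r_le : Rabs (phase_boundary (PI / 2) - phase_boundary d + N * J) <=
    2 * C * (cos d / sin d).
  apply: (norm_RInt_le phase_remainder (fun t => 2 * C * / sin t ^ 2) d (PI / 2)) => //.
    by move=> t tb; apply: phase_remainder_bound; lra.
  exact: is_RInt_Rscal (is_RInt_inv_sin_sqr db).
have B_d := phase_boundary_bound db.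
have : Rabs (phase_boundary (PI / 2)) <= C / 1.
  by rewrite -sin_PI2; apply: phase_boundary_bound; lra.
have i1 : 1 <= / sin d by rewrite -Rinv_1; apply: Rinv_le_contravar; [|case: (SIN_bound d)].
have Ci : C <= C / sin d by rewrite /Rdiv; nra.
have cd : 2 * C * (cos d / sin d) <= 2 * (C / sin d).
  by rewrite /Rdiv; have [_ c1] := COS_bound d; have : 0 <= C * / sin d; nra.
move=> B_PI2; apply: (Rmult_le_reg_l N); first lra.
rewrite -{1}(Rabs_right N); last lra.
rewrite -Rabs_mult (_ : N * (4 * C / (N * sin d)) = 4 * (C / sin d)); last by field; lra.
move: r_le B_d B_PI2 => /Rabs_le_between r_le /Rabs_le_between B_d /Rabs_le_between B_PI2.
by apply/Rabs_le_between; lra.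
Qed.

Lemma phase_integral_bound :
  Rabs (RInt (fun t => q t * w (N * cos t)) 0 (PI / 2)) <= 9 * C / sqrt N.
Proof.
have pi3 := PI2_3_2; have s1 := sqrt_ge1 N1; pose d := / sqrt N.
have d0 : 0 < d by apply: Rinv_0_lt_compat; lra.
have d1 : d <= 1 by rewrite /d -Rinv_1; apply: Rinv_le_contravar; lra.
have C0 : 0 <= C by apply: Rle_trans (Rabs_pos _) (q_bound 0).
rewrite -(RInt_Chasles _ 0 d); try exact: ex_RInt_phase_integrand.
apply: Rle_trans (Rabs_triang _ _) _.
have -> : 9 * C / sqrt N = (d - 0) * C + 8 * C * d by rewrite /d; field; lra.
apply: Rplus_le_compat.
  apply: abs_RInt_le_const => [||t _]; [lra|exact: ex_RInt_phase_integrand|].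
  rewrite Rabs_mult -(Rmult_1_r C); apply: Rmult_le_compat; try exact: Rabs_pos => //.
    exact: q_bound.
  exact: w_bound.
apply: Rle_trans (phase_integral_away _) _; first lra.
have sd := @sin_ge_half d ltac:(lra).
have -> : 8 * C * d = 4 * C * / (N * (d / 2)).
  by rewrite /d -{2}(sqrt_sqrt N); [field|]; lra.
apply: Rmult_le_compat_l; first lra.
by apply: Rinv_le_contravar; [nra|apply: Rmult_le_compat_l; lra].
Qed.

End CosinePhase.

(* The value of [parabola_moment j] at infinity is the mean [1 / 12] of [frac_parabola]
   times the integral of [cos_ratio j]. *)
Definition mean_moment (j : nat) : R := (- 1) ^ j * (PI / 2) / 12.

Definition inv_sqrt_decay (C l : R) (f : R -> R) : Prop :=
  forall x, 1 <= x -> Rabs (f x - l) <= C / sqrt x.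

Lemma parabola_moment_decay (j : nat) :
  exists2 C, 0 < C & inv_sqrt_decay C (mean_moment j) (parabola_moment j).
Proof.
have [C C0 qC] := cos_ratio_bounded j; exists (9 * C) => [|N N1]; first lra.
have -> : parabola_moment j N - mean_moment j =
    RInt (fun t => cos_ratio j t * centered_parabola (N * cos t)) 0 (PI / 2).
  apply/esym/is_RInt_unique; apply: is_RInt_eq (is_RInt_Rminus (is_RInt_parabola_moment j N)
    (is_RInt_Rscal (1 / 12) (is_RInt_cos_ratio (j := j) PI2_ge0))); first exact: PI2_ge0.
  - by move=> t _; rewrite /centered_parabola; ring.
  - by rewrite cos_ratio_prim_PI2 /mean_moment; field.
apply: (phase_integral_bound (dq := cos_ratio_deriv j)
  (W := centered_parabola_prim)) => // t.
- exact: is_derive_cos_ratio.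
- exact: continuous_cos_ratio_deriv.
- by case: (qC t).
- by case: (qC t).
- exact: is_derive_centered_parabola_prim.
- exact: continuous_centered_parabola.
- exact: centered_parabola_bound.
- exact: centered_parabola_prim_bound.
Qed.

(** * Logarithmic growth of [sum_d f (Z / d) / d] *)

Lemma Rabs_sum_le (F G : nat -> R) (m n : nat) :
  (forall i, (m <= i < n)%N -> Rabs (F i) <= G i) ->
  Rabs (\big[Rplus/0]_(m <= i < n) F i) <= \big[Rplus/0]_(m <= i < n) G i.
Proof.
move=> FG; rewrite big_nat [X in _ <= X]big_nat.
apply: (big_ind2 (fun x y => Rabs x <= y)) => //; first by rewrite Rabs_R0; lra.
by move=> x1 y1 x2 y2 le1 le2; apply: Rle_trans (Rabs_triang _ _) _; lra.
Qed.

Lemma sum_inv_sqrt_le (D : nat) :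
  \big[Rplus/0]_(1 <= d < D.+1) / sqrt (INR d) <= 2 * sqrt (INR D).
Proof.
elim: D => [|D IH]; first by rewrite big_geq //= sqrt_0; lra.
rewrite big_nat_recr //=; set S := \big[_/_]_(_ <= _ < _) _ in IH *.
have a0 : 0 < sqrt (INR D.+1) by apply: sqrt_lt_R0; apply: INR_gt0.
have aa : sqrt (INR D.+1) * sqrt (INR D.+1) = INR D + 1.
  by rewrite sqrt_sqrt; [rewrite S_INR|exact: pos_INR].
have bb : sqrt (INR D) * sqrt (INR D) = INR D by apply: sqrt_sqrt; apply: pos_INR.
have b0 := sqrt_pos (INR D).
move: (sqrt (INR D.+1)) (sqrt (INR D)) a0 aa bb b0 IH => a b a0 aa bb b0 IH.
suff : / a <= 2 * (a - b) by lra.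
by apply: (Rmult_le_reg_l a) => //; rewrite Rinv_r; nra.
Qed.

Definition dilate_sum (f : R -> R) (Z : R) (D : nat) : R :=
  \big[Rplus/0]_(1 <= d < D.+1) (f (Z / INR d) / INR d).

Lemma dilate_sumS (f : R -> R) (Z : R) (D : nat) :
  dilate_sum f Z D.+1 = dilate_sum f Z D + f (Z / INR D.+1) / INR D.+1.
Proof. by rewrite /dilate_sum big_nat_recr. Qed.

Definition log_prim (f : R -> R) (v : R) : R := RInt (fun w => f w / w) 1 v.

Lemma is_derive_log_prim (f : R -> R) (v : R) : (forall x, continuous f x) -> 0 < v ->
  is_derive (log_prim f) v (f v / v).
Proof.
move=> cf v0.
have c w : 0 < w -> continuous (fun w => f w / w) w.
  move=> w0; apply: (continuous_mult f) => //.
  by apply: ex_derive_continuousR; auto_derive; lra.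
apply: (is_derive_RInt (fun w => f w / w) _ 1); last exact: c.
apply: (locally_interval _ v 0 p_infty) => // b b0 _.
apply: RInt_correct; apply: ex_RInt_continuous => w [w0 _]; apply: c.
by apply: Rlt_le_trans w0; apply: Rmin_pos; [lra|exact: b0].
Qed.

Lemma log_prim_mean_value (f : R -> R) (l v w : R) : (forall x, continuous f x) ->
  0 < v <= w -> exists2 x, v <= x <= w &
    log_prim f w - log_prim f v - l * (ln w - ln v) = (f x - l) / x * (w - v).
Proof.
move=> cf [v0 vw].
have [x xb|x xb diffE] :=
  @mean_value (fun x => log_prim f x - l * ln x) (fun x => (f x - l) / x) v w vw.
  rewrite (_ : _ / x = f x / x - l * / x); last by field; lra.
  apply: is_derive_minus; first by apply: is_derive_log_prim => //; lra.
  by auto_derive; [|field]; lra.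
by exists x => //; rewrite -diffE; ring.
Qed.

Definition linearly_bounded (C : R) (f : R -> R) : Prop :=
  forall v, 0 < v -> Rabs (f v) <= C * v.

Lemma inv_square_bounded_dilates (C Z : R) (f : R -> R) : 0 < Z ->
  (forall v, 0 < v <= Z -> Rabs (f v) <= C * v) ->
  inv_square_bounded (C * Z) (fun d => f (Z / INR d) / INR d).
Proof.
move=> Z0 f_lin d d0; have d1 := INR_ge1 d0.
rewrite Rabs_mult Rabs_inv (Rabs_right (INR d)); last lra.
apply: Rle_trans (Rmult_le_compat_r _ _ _ _ (f_lin (Z / INR d) _)) _.
- by left; apply: Rinv_0_lt_compat; lra.
- split; first by apply: Rdiv_lt_0_compat; lra.
  by apply/Rle_div_l; nra.
- by right; field; lra.
Qed.

Definition rough_dilates (N : nat) (f : R -> R) (Z : R) : R :=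
  rough_series N (fun d => f (Z / INR d) / INR d).

Section DilateSums.
Variables (f : R -> R) (C l : R).
Hypothesis C0 : 0 < C.
Hypothesis f_lip : lipschitz C f.
Hypothesis f0 : f 0 = 0.
Hypothesis f_decay : inv_sqrt_decay C l f.

Let continuous_f (x : R) : continuous f x := lipschitz_continuous f_lip.

Lemma decay_le (v w : R) : 1 <= v <= w -> Rabs (f w - l) <= C / sqrt v.
Proof.
move=> vw; apply: Rle_trans (f_decay _) _; first lra.
apply: Rmult_le_compat_l; first lra.
by apply: Rinv_le_contravar; [apply: sqrt_lt_R0; lra|apply: sqrt_le_1_alt; lra].
Qed.

Lemma decay_bounded (v : R) : 0 <= v -> Rabs (f v) <= C + Rabs l.
Proof.
move=> v0; have l0 := Rabs_pos l; have [v1|v1] := Rle_lt_dec v 1.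
  by have := lipschitz_linear f_lip f0 v0; nra.
have := @decay_le 1 v ltac:(lra); rewrite sqrt_1 Rdiv_1_r.
by have := Rabs_triang (f v - l) l; rewrite (_ : f v - l + l = f v); [lra|ring].
Qed.

(* [f (Z / d) / d] is compared with the integral of [f (Z / t) / t] over [[d - 1, d]];
   this is accurate only when [d] is large compared with [sqrt Z]. *)
Lemma dilate_sum_step (Z : R) (d : nat) : 0 < Z -> (0 < d)%N ->
  Rabs (f (Z / INR d.+1) / INR d.+1
    - (log_prim f (Z / INR d) - log_prim f (Z / INR d.+1)))
  <= (C * Z / INR d + (C + Rabs l)) * (/ INR d - / INR d.+1).
Proof.
move=> Z0 /INR_gt0; rewrite S_INR; set n := INR d => n0.
have nn1 : n <= n + 1 by lra.
have [t tb|t tb diffE] :=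
    @mean_value (fun t => log_prim f (Z / t)) (fun t => - (f (Z / t) / t)) n (n + 1) nn1.
  have Zt : 0 < Z / t by apply: Rdiv_lt_0_compat; lra.
  rewrite (_ : - _ = (- Z / t ^ 2) * (f (Z / t) / (Z / t))); last by field; lra.
  apply: (is_derive_comp (log_prim f) (fun t => Z / t)); first exact: is_derive_log_prim.
  by auto_derive; [|field]; lra.
have -> : log_prim f (Z / n) - log_prim f (Z / (n + 1)) = f (Z / t) / t by lra.
have it : / t <= / n by apply: Rinv_le_contravar; lra.
have it' : / (n + 1) <= / t by apply: Rinv_le_contravar; lra.
have i0 : 0 < / (n + 1) by apply: Rinv_0_lt_compat; lra.
have -> : f (Z / (n + 1)) / (n + 1) - f (Z / t) / t =
   (f (Z / (n + 1)) - f (Z / t)) * / (n + 1) + f (Z / t) * (/ (n + 1) - / t).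
  by field; lra.
apply: Rle_trans (Rabs_triang _ _) _; rewrite !Rabs_mult (Rabs_right (/ (n + 1))); last lra.
rewrite (Rabs_left1 (/ (n + 1) - / t)) ?(Rmult_plus_distr_r _ (C + Rabs l)); last lra.
have CZn : C * Z / n * (/ n - / (n + 1)) = C * (Z * (/ n - / (n + 1))) * / n by field; lra.
apply: Rplus_le_compat.
  rewrite CZn; apply: Rmult_le_compat; try lra; first exact: Rabs_pos.
  apply: Rle_trans (f_lip _ _) _; apply: Rmult_le_compat_l; first lra.
  by rewrite /Rdiv Rabs_left1; nra.
have := @decay_bounded (Z / t) ltac:(apply: Rdiv_le_0_compat; lra).
by move=> fM; apply: Rmult_le_compat; try lra; exact: Rabs_pos.
Qed.

Lemma dilate_sum_tail (Z : R) (D E : nat) : 0 < Z -> (0 < D <= E)%N ->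
  Rabs (dilate_sum f Z E - dilate_sum f Z D
    - (log_prim f (Z / INR D) - log_prim f (Z / INR E)))
  <= (C * Z / INR D + (C + Rabs l)) / INR D.
Proof.
move=> Z0 /andP [D0 DE]; set M := C + _; have D_gt0 := INR_gt0 D0.
have M0 : 0 <= M by have := Rabs_pos l; rewrite /M; lra.
pose K := C * Z / INR D + M.
have K0 : 0 <= K by have : 0 <= C * Z / INR D; [apply: Rdiv_le_0_compat|rewrite /K]; nra.
have := @telescoping_dist (fun n => dilate_sum f Z n + log_prim f (Z / INR n))
  (fun n => K * / INR n) D E DE.
rewrite (_ : _ + _ - _ = dilate_sum f Z E - dilate_sum f Z D
  - (log_prim f (Z / INR D) - log_prim f (Z / INR E))); last by ring.
move=> le_K; apply: Rle_trans (le_K _) _; last first.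
  have : 0 < / INR E by apply: Rinv_0_lt_compat; apply: INR_gt0; lia.
  by rewrite -/K /Rdiv; nra.
move=> n Dn; have n0 : (0 < n)%N by lia.
rewrite dilate_sumS -Rmult_minus_distr_l.
rewrite (_ : _ + _ + _ - _ = f (Z / INR n.+1) / INR n.+1
  - (log_prim f (Z / INR n) - log_prim f (Z / INR n.+1))); last by ring.
apply: Rle_trans (dilate_sum_step Z0 n0) _.
apply: Rmult_le_compat_r.
  by have := Rinv_le_contravar _ _ (INR_gt0 n0) (le_INR n n.+1 ltac:(lia)); lra.
apply: Rplus_le_compat_r; apply: Rmult_le_compat_l; first nra.
by apply: Rinv_le_contravar => //; apply: le_INR; lia.
Qed.

Lemma dilate_sum_head (Z lam : R) (D : nat) : 0 < Z -> 1 <= lam -> INR D <= Z ->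
  Rabs (dilate_sum f (lam * Z) D - dilate_sum f Z D) <= 4 * C * sqrt (INR D / Z).
Proof.
move=> Z0 lam1 DZ; have sZ := sqrt_lt_R0 _ Z0.
have -> : dilate_sum f (lam * Z) D - dilate_sum f Z D =
    \big[Rplus/0]_(1 <= d < D.+1) ((f (lam * Z / INR d) - f (Z / INR d)) / INR d).
  rewrite (_ : _ - _ = dilate_sum f (lam * Z) D + (-1) * dilate_sum f Z D); last by ring.
  rewrite /dilate_sum big_distrr -big_split; apply: eq_bigr => d _.
  by rewrite /= /Rdiv; ring.
apply: Rle_trans (Rabs_sum_le (G := fun d => 2 * C / sqrt Z * / sqrt (INR d)) _) _;
  last first.
  rewrite -big_distrr /= sqrt_div_alt //.
  rewrite (_ : 4 * C * _ = 2 * C / sqrt Z * (2 * sqrt (INR D))); last by field; lra.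
  apply: Rmult_le_compat_l; last exact: sum_inv_sqrt_le.
  by apply: Rdiv_le_0_compat; lra.
move=> d /andP [d0 dD]; have d_gt0 := INR_gt0 d0; have sd := sqrt_lt_R0 _ d_gt0.
have dZ : INR d <= Z by apply: Rle_trans DZ; apply: le_INR; lia.
have Zd1 : 1 <= Z / INR d by apply/Rle_div_r; lra.
have dec1 := @decay_le (Z / INR d) (Z / INR d) ltac:(lra).
have dec2 : Rabs (f (lam * Z / INR d) - l) <= C / sqrt (Z / INR d).
  by apply: decay_le; split=> //; rewrite /Rdiv Rmult_assoc; rewrite /Rdiv in Zd1; nra.
rewrite Rabs_mult Rabs_inv (Rabs_right (INR d)); last lra.
apply/Rle_div_l => //.
rewrite (_ : _ * INR d = 2 * (C / sqrt (Z / INR d))); last first.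
  by rewrite sqrt_div_alt // -{2}(sqrt_sqrt (INR d)); [field|]; lra.
move: dec1 dec2 => /Rabs_le_between ? /Rabs_le_between ?.
by apply/Rabs_le_between; lra.
Qed.

Lemma log_prim_dilate (v lam : R) : 1 <= v -> 1 <= lam ->
  Rabs (log_prim f (lam * v) - log_prim f v - l * ln lam) <= C * lam / sqrt v.
Proof.
move=> v1 lam1; have sv := sqrt_lt_R0 v ltac:(lra).
have [|x [vx xv] diffE] := log_prim_mean_value l (v := v) (w := lam * v) continuous_f.
  by nra.
rewrite ln_mult in diffE; try lra.
rewrite (_ : ln lam = ln lam + ln v - ln v); last by ring.
have x_le : 0 <= / x * (lam * v - v) <= lam.
  have x0 : 0 < x by lra.
  split; first by apply: Rmult_le_pos; [left; apply: Rinv_0_lt_compat|nra].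
  by rewrite Rmult_comm; apply/Rle_div_l; nra.
rewrite diffE /Rdiv (Rmult_assoc (f x - l)) Rabs_mult (Rabs_right (_ * _)); last lra.
rewrite (_ : C * lam * / sqrt v = C / sqrt v * lam); last by rewrite /Rdiv; ring.
by apply: Rmult_le_compat; try lra; [exact: Rabs_pos|apply: decay_le; lra].
Qed.

Lemma log_prim_dilate_le (v lam : R) : 0 < v -> 1 <= lam ->
  Rabs (log_prim f (lam * v) - log_prim f v) <= C * lam * v.
Proof.
move=> v0 lam1.
have [|x [vx xv]] := log_prim_mean_value 0 (v := v) (w := lam * v) continuous_f.
  by nra.
rewrite Rmult_0_l !Rminus_0_r => ->.
have x0 : 0 < x by lra.
rewrite Rabs_mult /Rdiv Rabs_mult Rabs_inv (Rabs_right x) ?(Rabs_right (_ - _)); try nra.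
have fx : Rabs (f x) * / x <= C.
  by apply/Rle_div_l => //; apply: lipschitz_linear f_lip f0 _; lra.
have : 0 <= Rabs (f x) * / x.
  by apply: Rmult_le_pos; [exact: Rabs_pos|left; apply: Rinv_0_lt_compat].
have : 0 <= (lam - 1) * v by apply: Rmult_le_pos; lra.
by move=> ? ?; rewrite (Rmult_assoc C); apply: Rmult_le_compat; lra.
Qed.

Lemma dilate_sum_slope (Z lam : R) (D E : nat) : (0 < D <= E)%N -> INR D <= Z -> 1 <= lam ->
  Rabs (dilate_sum f (lam * Z) E - dilate_sum f Z E - l * ln lam) <=
  (4 + lam) * C * sqrt (INR D / Z) + 2 * (C * lam * Z / INR D + (C + Rabs l)) / INR D
  + C * lam * Z / INR E.
Proof.
move=> DE DZ lam1; have [D0 E0] : 0 < INR D /\ 0 < INR E by split; apply: INR_gt0; lia.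
have Z0 : 0 < Z by lra.
have lZ0 : 0 < lam * Z by nra.
have ZD1 : 1 <= Z / INR D by apply/Rle_div_r; lra.
have head := dilate_sum_head Z0 lam1 DZ.
have tail1 := dilate_sum_tail lZ0 DE; have tail2 := dilate_sum_tail Z0 DE.
have mid := log_prim_dilate ZD1 lam1.
have far := @log_prim_dilate_le (Z / INR E) lam ltac:(exact: Rdiv_lt_0_compat) lam1.
have tail_le : (C * Z / INR D + (C + Rabs l)) / INR D <=
    (C * (lam * Z) / INR D + (C + Rabs l)) / INR D.
  apply: Rmult_le_compat_r; first by left; apply: Rinv_0_lt_compat.
  apply: Rplus_le_compat_r.
  apply: Rmult_le_compat_r; first by left; apply: Rinv_0_lt_compat.
  by apply: Rmult_le_compat_l; nra.
rewrite (_ : C * lam / sqrt (Z / INR D) = C * lam * sqrt (INR D / Z)) in mid; last first.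
  by rewrite /Rdiv -sqrt_inv Rinv_div.
rewrite -!(Rmult_div_assoc lam) in tail1 tail_le.
rewrite -!(Rmult_div_assoc C) in tail1 tail2 tail_le.
rewrite -(Rmult_div_assoc (C * lam) Z (INR E)) -(Rmult_div_assoc (C * lam) Z (INR D)).
move: head tail1 tail2 mid far => /Rabs_le_between ? /Rabs_le_between ? /Rabs_le_between ?.
move=> /Rabs_le_between ? /Rabs_le_between ?.
by apply/Rabs_le_between; split; lra.
Qed.

Lemma is_lim_dilate_sum (Z : R) : 0 < Z ->
  is_lim_seq (dilate_sum f Z) (rough_dilates 0 f Z).
Proof.
move=> Z0; apply: (is_lim_rough_series (C := C * Z) _ 0).
apply: inv_square_bounded_dilates => // v v0.
by apply: lipschitz_linear f_lip f0 _; lra.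
Qed.

Lemma dilates_slope (Z lam : R) (D : nat) : (0 < D)%N -> INR D <= Z -> 1 <= lam ->
  Rabs (rough_dilates 0 f (lam * Z) - rough_dilates 0 f Z - l * ln lam) <=
  (4 + lam) * C * sqrt (INR D / Z) + 2 * (C * lam * Z / INR D + (C + Rabs l)) / INR D.
Proof.
move=> D0 DZ lam1; have Z0 : 0 < Z by have := INR_gt0 D0; lra.
have lZ0 : 0 < lam * Z by nra.
set B := _ + 2 * _ / _.
have lim_diff := is_lim_seq_minus' _ _ _ _ (is_lim_dilate_sum lZ0) (is_lim_dilate_sum Z0).
have lim_bound : is_lim_seq (fun E => B + C * lam * Z / INR E) (B + 0).
  by apply: is_lim_seq_plus'; [exact: is_lim_seq_const|exact: is_lim_seq_div_INR].
rewrite -(Rplus_0_r B); apply: is_lim_seq_dist_le lim_diff lim_bound.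
by exists D => E DE; apply: dilate_sum_slope => //; rewrite D0; lia.
Qed.

End DilateSums.

Definition unif_lim_infty (T : Type) (F : T -> R -> R) (l : T -> R) : Prop :=
  forall eps, 0 < eps -> exists2 Z0, 0 < Z0 &
  forall t Z, Z0 <= Z -> Rabs (F t Z - l t) <= eps.

Lemma cutoff_head_le (s n : R) : 0 < s -> 0 <= n <= s ^ 3 -> sqrt (n / s ^ 4) <= / sqrt s.
Proof.
move=> s0 n_le; have s4 : 0 < s ^ 4 by apply: pow_lt.
rewrite -sqrt_inv; apply: sqrt_le_1_alt; apply/Rle_div_l => //.
by rewrite (_ : / s * s ^ 4 = s ^ 3); [lra|field; lra].
Qed.

Lemma cutoff_tail_le (s n A M : R) : 1 <= s -> s ^ 3 / 2 <= n -> 0 <= A -> 0 <= M ->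
  (A * s ^ 4 / n + M) / n <= (4 * A + 2 * M) / sqrt s.
Proof.
move=> s1 n_ge A0 M0; have s3 : 0 < s ^ 3 by apply: pow_lt; lra.
have i0 : 0 < / n by apply: Rinv_0_lt_compat; lra.
have i_le : / n <= 2 * / s ^ 3.
  by rewrite (_ : 2 * / s ^ 3 = / (s ^ 3 / 2)); [apply: Rinv_le_contravar|field]; lra.
have As0 : 0 <= A * s ^ 4 by apply: Rmult_le_pos => //; apply: pow_le; lra.
have As : A * s ^ 4 / n <= 2 * A * s.
  apply: Rle_trans (Rmult_le_compat_l _ _ _ As0 i_le) _.
  by right; field; lra.
apply: Rle_trans (_ : (2 * A * s + M) * (2 * / s ^ 3) <= _).
  apply: Rmult_le_compat; try lra.
  by have : 0 <= A * s ^ 4 / n; [apply: Rmult_le_pos; lra|lra].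
apply: Rle_trans (_ : (4 * A + 2 * M) * / s <= _); last first.
  apply: Rmult_le_compat_l; first lra.
  apply: Rinv_le_contravar; first by apply: sqrt_lt_R0; lra.
  by rewrite -{2}(sqrt_sqrt s); have := sqrt_ge1 s1; nra.
have is0 : 0 < / s by apply: Rinv_0_lt_compat; lra.
have is1 : / s <= 1 by rewrite -Rinv_1; apply: Rinv_le_contravar; lra.
have -> : (2 * A * s + M) * (2 * / s ^ 3) =
    4 * A * (/ s * / s) + 2 * M * (/ s * / s * / s) by field; lra.
have sq : / s * / s <= / s by nra.
have cube : / s * / s * / s <= / s by nra.
by nra.
Qed.

(* The cutoff in [dilates_slope] is [D = floor (Z ^ (3 / 4))], with [Z = s ^ 4]. *)
Lemma dilates_slope_decay (f : R -> R) (C l Lam : R) : 0 < C -> lipschitz C f -> f 0 = 0 ->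
  inv_sqrt_decay C l f -> 0 <= Lam ->
  exists2 K, 0 < K & forall s lam, 2 <= s -> 1 <= lam <= Lam ->
    Rabs (rough_dilates 0 f (lam * s ^ 4) - rough_dilates 0 f (s ^ 4) - l * ln lam) <=
    K / sqrt s.
Proof.
move=> C0 f_lip f0 f_decay Lam0; have M0 : 0 <= C + Rabs l by have := Rabs_pos l; lra.
move: (C + Rabs l) M0 (dilates_slope C0 f_lip f0 f_decay) => M M0 slope_le.
exists ((4 + Lam) * C + 2 * (4 * (C * Lam) + 2 * M)); first nra.
move=> s lam s2 [lam1 lamL]; have s3 : 2 ^ 3 <= s ^ 3 by apply: pow_incr; lra.
have [D [D_le D_gt]] := nfloor_ex (s ^ 3) ltac:(lra).
have D0 : (0 < D)%N by apply/ltP/INR_lt => /=; lra.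
have D_gt0 := INR_gt0 D0; have s34 : s ^ 4 = s ^ 3 * s by ring.
apply: Rle_trans (slope_le _ _ _ D0 _ lam1) _; first by rewrite s34; nra.
have head := @cutoff_head_le s (INR D) ltac:(lra) ltac:(lra).
have tail := @cutoff_tail_le s (INR D) (C * lam) M ltac:(lra) ltac:(lra) ltac:(nra) M0.
have i0 : 0 < / sqrt s by apply: Rinv_0_lt_compat; apply: sqrt_lt_R0; lra.
rewrite (_ : (_ + 2 * _) / sqrt s = (4 + Lam) * C * / sqrt s
  + 2 * ((4 * (C * Lam) + 2 * M) / sqrt s)); last by rewrite /Rdiv; ring.
apply: Rplus_le_compat.
  by apply: Rmult_le_compat => //; [nra|exact: sqrt_pos|nra].
have CLam : (4 * (C * lam) + 2 * M) / sqrt s <= (4 * (C * Lam) + 2 * M) / sqrt s.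
  by apply: Rmult_le_compat_r; nra.
by rewrite /Rdiv in tail CLam *; lra.
Qed.

Lemma dilates_slope_unif (f : R -> R) (C l Lam : R) : 0 < C -> lipschitz C f -> f 0 = 0 ->
  inv_sqrt_decay C l f -> 0 <= Lam ->
  unif_lim_infty
    (fun (lam : {x : R | 1 <= x <= Lam}) Z =>
       rough_dilates 0 f (sval lam * Z) - rough_dilates 0 f Z)
    (fun lam => l * ln (sval lam)).
Proof.
move=> C0 f_lip f0 f_decay Lam0 eps eps0.
have [K K0 slopeK] := dilates_slope_decay C0 f_lip f0 f_decay Lam0.
pose s0 := Rmax 2 ((K / eps) ^ 2).
have [s0_2 s0_K] : 2 <= s0 /\ (K / eps) ^ 2 <= s0 by split; [apply: Rmax_l|apply: Rmax_r].
exists (s0 ^ 4) => [|[lam lamL] Z ZZ0]; first by apply: pow_lt; lra.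
rewrite [sval _]/=.
have s0Z : s0 <= sqrt (sqrt Z).
  rewrite -(sqrt_pow2 s0); last lra.
  apply: sqrt_le_1_alt; rewrite -(sqrt_pow2 (s0 ^ 2)); last by apply: pow2_ge_0.
  by apply: sqrt_le_1_alt; rewrite -pow_mult.
have Z0 : 0 <= Z by apply: Rle_trans ZZ0; apply: pow_le; lra.
have -> : Z = sqrt (sqrt Z) ^ 4.
  rewrite (_ : _ ^ 4 = (sqrt (sqrt Z) ^ 2) ^ 2); last by ring.
  by rewrite !pow2_sqrt //; apply: sqrt_pos.
move: (sqrt (sqrt Z)) s0Z => s s0s {ZZ0 Z0}.
apply: Rle_trans (slopeK s lam _ lamL) _; first lra.
have Ks : K / eps <= sqrt s.
  rewrite -(sqrt_pow2 (K / eps)); first by apply: sqrt_le_1_alt; lra.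
  by apply: Rdiv_le_0_compat; lra.
apply/Rle_div_l; first by apply: sqrt_lt_R0; lra.
by move/Rle_div_l: Ks => /(_ eps0); lra.
Qed.

(** * Accumulating corrections of total size [O(sum n^-2)] *)

Section DilationCorrections.
Variables (T : Type) (F : nat -> T -> R -> R) (s a b : nat -> R) (B C : R).
Hypothesis s_gt0 : forall n, 0 < s n.
Hypothesis F_rec : forall n t Z, 0 < Z ->
  F n.+1 t Z = F n t Z + a n * F n t (Z / s n) + b n * F n t (Z / s n ^ 2).
Hypothesis corrections_le : forall n, Rabs (a n) + Rabs (b n) <= C / INR n.+1 ^ 2.
Hypothesis B_ge0 : 0 <= B.
Hypothesis F0_bounded : forall t Z, 0 < Z -> Rabs (F 0 t Z) <= B.

Definition correction_prod (n : nat) : R := \big[Rmult/1]_(0 <= i < n) (1 + a i + b i).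

Lemma correction_increment (n : nat) (t : T) (Z K : R) : 0 < Z ->
  (forall t Z, 0 < Z -> Rabs (F n t Z) <= K) ->
  Rabs (F n.+1 t Z - F n t Z) <= C / INR n.+1 ^ 2 * K.
Proof.
move=> Z0 FK; have sn := s_gt0 n.
have FK_s := FK t _ (Rdiv_lt_0_compat _ _ Z0 sn).
have FK_s2 := FK t _ (Rdiv_lt_0_compat _ _ Z0 (pow_lt _ 2 sn)).
rewrite F_rec // (_ : _ - _ = a n * F n t (Z / s n) + b n * F n t (Z / s n ^ 2));
  last by ring.
apply: Rle_trans (Rabs_triang _ _) _; rewrite !Rabs_mult.
apply: Rle_trans (_ : (Rabs (a n) + Rabs (b n)) * K <= _).
  rewrite Rmult_plus_distr_r.
  by apply: Rplus_le_compat; apply: Rmult_le_compat_l => //; apply: Rabs_pos.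
by apply: Rmult_le_compat_r => //; apply: Rle_trans (Rabs_pos _) FK_s.
Qed.

Lemma corrections_bounded (n : nat) (t : T) (Z : R) : 0 < Z ->
  Rabs (F n t Z) <= B * exp (2 * C).
Proof.
have C0 : 0 <= C.
  have := corrections_le 0; rewrite pow1.
  by have := Rabs_pos (a 0%N); have := Rabs_pos (b 0%N); lra.
move=> Z0; pose Q n K := forall t Z, 0 < Z -> Rabs (F n t Z) <= K.
have [i K QK|K [_ KB] QK] := @inv_square_growth Q B C B_ge0 C0 F0_bounded _ n; last first.
  exact: Rle_trans (QK t Z Z0) KB.
move=> u y y0; have := correction_increment u y0 QK; have := QK u y y0.
have := Rabs_triang (F i.+1 u y - F i u y) (F i u y).
by rewrite (_ : _ - _ + _ = F i.+1 u y); [lra|ring].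
Qed.

Lemma corrections_dist (m n : nat) (t : T) (Z : R) : 0 < Z -> (m <= n)%N ->
  Rabs (F n t Z - F m t Z) <= 2 * (C * (B * exp (2 * C))) / INR m.+1.
Proof.
move=> Z0 mn.
apply: (inv_square_increments_dist (u := fun n => F n t Z)) mn => i.
rewrite /Rdiv Rmult_assoc (Rmult_comm _ (/ _)) -Rmult_assoc.
exact: correction_increment (corrections_bounded i).
Qed.

Variable l : T -> R.
Hypothesis F0_lim : unif_lim_infty (F 0) l.

Lemma corrections_unif_lim (n : nat) :
  unif_lim_infty (F n) (fun t => l t * correction_prod n).
Proof.
elim: n => [|n IH] eps eps0.
  have [Z0 Z0_gt0 F0_near] := F0_lim eps0; exists Z0 => // t Z ZZ0.
  by rewrite /correction_prod big_geq // Rmult_1_r; apply: F0_near.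
have [a0 b0] := (Rabs_pos (a n), Rabs_pos (b n)).
pose w := 1 + Rabs (a n) + Rabs (b n); have w0 : 0 < w by rewrite /w; lra.
have [Z0 Z0_gt0 F_near] := IH (eps / w) (Rdiv_lt_0_compat _ _ eps0 w0).
have sn := s_gt0 n; have sn2 : 0 < s n ^ 2 by apply: pow_lt.
exists (Z0 * Rmax 1 (Rmax (s n) (s n ^ 2))) => [|t Z ZZ0].
  by apply: Rmult_lt_0_compat => //; apply: Rlt_le_trans Rlt_0_1 (Rmax_l _ _).
have far u : 0 < u -> u <= Rmax 1 (Rmax (s n) (s n ^ 2)) -> Z0 <= Z / u.
  move=> u0 u_le; apply/Rle_div_r => //; apply: Rle_trans ZZ0.
  by apply: Rmult_le_compat_l; lra.
have Z1 : 0 < Z.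
  by have := far 1 Rlt_0_1 (Rmax_l _ _); rewrite Rdiv_1_r; lra.
have near1 : Rabs (F n t Z - l t * correction_prod n) <= eps / w.
  by apply: F_near; have := far 1 Rlt_0_1 (Rmax_l _ _); rewrite Rdiv_1_r.
have near_s := F_near t _ (far (s n) sn (Rle_trans _ _ _ (Rmax_l _ _) (Rmax_r _ _))).
have near_s2 := F_near t _ (far (s n ^ 2) sn2 (Rle_trans _ _ _ (Rmax_r _ _) (Rmax_r _ _))).
rewrite F_rec // /correction_prod big_nat_recr //= -/(correction_prod n).
rewrite (_ : _ - _ = (F n t Z - l t * correction_prod n)
   + (a n * (F n t (Z / s n) - l t * correction_prod n)
   + b n * (F n t (Z / s n ^ 2) - l t * correction_prod n))); last by rewrite /=; ring.
have -> : eps = eps / w + (Rabs (a n) * (eps / w) + Rabs (b n) * (eps / w)).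
  by rewrite {1}(_ : eps = w * (eps / w)); [rewrite /w; ring|field; lra].
apply: Rle_trans (Rabs_triang _ _) _; apply: Rplus_le_compat => //.
apply: Rle_trans (Rabs_triang _ _) _; rewrite !Rabs_mult.
by apply: Rplus_le_compat; apply: Rmult_le_compat_l.
Qed.

Lemma corrections_lim (Flim : T -> R -> R) (A L : R) :
  (forall t Z, 0 < Z -> is_lim_seq (fun n => F n t Z) (Flim t Z)) ->
  (forall t, Rabs (l t) <= L) -> is_lim_seq correction_prod A ->
  unif_lim_infty Flim (fun t => l t * A).
Proof.
move=> F_lim l_le A_lim eps eps0; have eps3 : 0 < eps / 3 by lra.
pose D := 2 * (C * (B * exp (2 * C))).
have [N1 tail_lt] := eventually_div_INR_lt D eps3.
pose L1 := Rmax L 1; have L1_gt0 : 0 < L1 := Rlt_le_trans _ _ _ Rlt_0_1 (Rmax_r _ _).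
have epsL : 0 < eps / 3 / L1 by apply: Rdiv_lt_0_compat.
have /is_lim_seq_spec /(_ (mkposreal _ epsL)) [N2 prod_lt] := A_lim.
pose n := (N1 + N2)%N; have [Z0 Z0_gt0 F_near] := corrections_unif_lim n eps3.
exists Z0 => // t Z ZZ0; have Z1 : 0 < Z by lra.
have lim_close : Rabs (Flim t Z - F n t Z) <= eps / 3.
  apply: Rle_trans (Rlt_le _ _ (tail_lt n.+1 ltac:(lia))).
  apply: is_lim_seq_dist_le (F_lim t Z Z1) (is_lim_seq_const _).
  by exists n => m nm; apply: corrections_dist => //; lia.
have prod_close : Rabs (l t * correction_prod n - l t * A) <= eps / 3.
  rewrite -Rmult_minus_distr_l Rabs_mult.
  apply: Rle_trans (_ : L1 * (eps / 3 / L1) <= _); last by right; field; lra.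
  apply: Rmult_le_compat; try exact: Rabs_pos.
    exact: Rle_trans (l_le t) (Rmax_l _ _).
  by left; apply: prod_lt; lia.
move: lim_close prod_close (F_near t Z ZZ0).
move=> /Rabs_le_between ? /Rabs_le_between ? /Rabs_le_between ?.
by apply/Rabs_le_between; lra.
Qed.

End DilationCorrections.

(** * The sums [sum_r V r * r * ramp_moment (Z / r)] *)

Definition floor_nat (Z : R) : nat := Z.to_nat (Int_part Z).

Lemma floor_natP (Z : R) : 0 <= Z -> INR (floor_nat Z) <= Z < INR (floor_nat Z).+1.
Proof.
move=> Z0; have [Z_ge Z_lt] := base_Int_part Z.
have i0 : (0 <= Int_part Z)%Z.
  by have : (-1 < Int_part Z)%Z; [apply: lt_IZR; lra|lia].
by rewrite S_INR /floor_nat INR_IZR_INZ Z2Nat.id //; lra.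
Qed.

Definition kernel_sum (k : R -> R) (W : nat -> R) (M : nat) (Z : R) : R :=
  \big[Rplus/0]_(1 <= r < M.+1) (W r * k (Z / INR r)).

Lemma kernel_sum_cutoff (k : R -> R) (W : nat -> R) (M1 M2 : nat) (Z : R) :
  (forall z, 0 <= z <= 1 -> k z = 0) -> 0 < Z -> Z <= INR M1.+1 -> Z <= INR M2.+1 ->
  kernel_sum k W M1 Z = kernel_sum k W M2 Z.
Proof.
move=> k0 Z0; wlog M12 : M1 M2 / (M1 <= M2)%N => [sym ZM1 ZM2|ZM1 _].
  by have [/sym|/ltnW/sym] := leqP M1 M2; [apply|move=> ->].
rewrite /kernel_sum [RHS](big_cat_nat (n := M1.+1)) //= [X in _ + X]big_nat.
rewrite [X in _ + X]big1 ?Rplus_0_r // => r /andP [M1r _].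
have rZ : Z <= INR r by apply: Rle_trans ZM1 (le_INR _ _ _); lia.
by rewrite k0 ?Rmult_0_r //; split; [apply: Rdiv_le_0_compat|apply/Rle_div_l]; lra.
Qed.

Definition ramp_sum (j : nat) (V : nat -> R) : nat -> R -> R :=
  kernel_sum (ramp_moment j) (fun r => V r * INR r).

Definition completed_sum (j : nat) (V : nat -> R) (c Z : R) : R :=
  ramp_sum j V (floor_nat Z) Z + c * linear_coef j * Z.

Lemma completed_sumE (j : nat) (V : nat -> R) (c Z : R) (M : nat) : 0 < Z ->
  Z <= INR M.+1 ->
  completed_sum j V c Z = ramp_sum j V M Z + c * linear_coef j * Z.
Proof.
move=> Z0 ZM; rewrite /completed_sum /ramp_sum (kernel_sum_cutoff _ _ Z0 _ ZM) //.
  exact: ramp_moment_le1.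
by have := @floor_natP Z; lra.
Qed.

Lemma completed_sum_cst1 (j : nat) (Z : R) : (0 < j)%N -> 0 < Z ->
  completed_sum j (fun=> 1) 1 Z = parabola_moment j Z.
Proof.
move=> j0 Z0; have [_ ZM] := @floor_natP Z (Rlt_le _ _ Z0); set M := floor_nat Z in ZM.
rewrite (parabola_moment_sum (M := M.+1)) //; last lra.
rewrite (completed_sumE _ _ _ Z0 (M := M.+1)); last by rewrite S_INR; lra.
rewrite Rmult_1_l; congr (_ + _).
by apply: eq_bigr => r _; rewrite Rmult_1_l.
Qed.

Lemma completed_sum_mul (j p : nat) (V V' : nat -> R) (a c Z : R) : (0 < p)%N -> 0 < Z ->
  (forall r, (0 < r)%N -> V' r = V r + a * (if (p %| r)%N then V (r %/ p)%N else 0)) ->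
  completed_sum j V' (c * (1 + a)) Z =
  completed_sum j V c Z + INR p * a * completed_sum j V c (Z / INR p).
Proof.
move=> p0 Z0 V'E; have [p_gt0 p1] := (INR_gt0 p0, INR_ge1 p0).
have [_ ZM] := @floor_natP Z (Rlt_le _ _ Z0); set M := floor_nat Z in ZM.
have ZpM : Z <= INR (p * M).+1.
  by apply: Rle_trans (Rlt_le _ _ ZM) (le_INR _ _ _); have := leq_pmull M p0; lia.
have Zp0 : 0 < Z / INR p by apply: Rdiv_lt_0_compat.
have Z'M : Z / INR p <= INR M.+1 by apply/Rle_div_l => //; nra.
rewrite !(completed_sumE _ _ _ Z0 ZpM) (completed_sumE _ _ _ Zp0 Z'M).
have -> : ramp_sum j V' (p * M) Z =
    ramp_sum j V (p * M) Z + INR p * a * ramp_sum j V M (Z / INR p).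
  pose F r := a * V (r %/ p)%N * (INR r * ramp_moment j (Z / INR r)).
  have <- : \big[Rplus/0]_(1 <= r < (p * M).+1 | (p %| r)%N) F r =
      INR p * a * ramp_sum j V M (Z / INR p).
    rewrite (big_multiples F predT) // /ramp_sum /kernel_sum big_distrr.
    rewrite [LHS]big_nat [RHS]big_nat.
    apply: eq_bigr => m /andP [/INR_gt0 m0 _].
    rewrite /F mulKn // -multE mult_INR (_ : Z / (INR p * INR m) = Z / INR p / INR m) /=.
      by ring.
    by field; lra.
  rewrite big_mkcond -big_split /ramp_sum /kernel_sum [LHS]big_nat [RHS]big_nat.
  by apply: eq_bigr => r /andP [r0 _]; rewrite V'E // /F /=; case: ifP => _; ring.
by field; lra.
Qed.

(** * The weights of [nu] *)

Definition nu_weight (p : nat) : R :=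
  INR p ^ 2 / (INR p ^ 4 - 2 * INR p ^ 2 - INR p + 1).

Definition nu_trunc (N r : nat) : R :=
  \big[Rmult/1]_(0 <= p < N | prime p && (p %| r)%N) (1 + nu_weight p).

Lemma nu_truncE (N r : nat) : (0 < r < N)%N -> nu_trunc N r = nu r.
Proof.
move=> /andP [r0 rN]; rewrite /nu /nu_trunc -big_filter; apply: perm_big.
apply: uniq_perm; [exact/filter_uniq/iota_uniq|exact: primes_uniq|move=> p].
rewrite mem_filter mem_index_iota mem_primes r0 /=.
case: (prime p) => //=; case pr: (p %| r)%N => //=.
by apply: leq_ltn_trans rN; apply: dvdn_leq.
Qed.

Lemma nu_trunc_mulp (p m : nat) : prime p -> nu_trunc p (p * m) = nu_trunc p m.
Proof.
move=> pp; rewrite /nu_trunc big_nat_cond [RHS]big_nat_cond; apply: eq_bigl => q.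
case qp: (0 <= q < p)%N => //=; case qq: (prime q) => //=.
rewrite Euclid_dvdM // dvdn_prime2 //; case: eqP => // qE.
by rewrite qE ltnn in qp.
Qed.

Lemma nu_truncS_not_prime (N r : nat) : ~~ prime N -> nu_trunc N.+1 r = nu_trunc N r.
Proof.
move=> np; rewrite /nu_trunc big_mkcond big_nat_recr //= -big_mkcond.
by rewrite (negbTE np) Rmult_1_r.
Qed.

Lemma nu_truncS_prime (p r : nat) : prime p ->
  nu_trunc p.+1 r =
  nu_trunc p r + nu_weight p * (if (p %| r)%N then nu_trunc p (r %/ p) else 0).
Proof.
move=> pp; rewrite {1}/nu_trunc big_mkcond big_nat_recr //= -big_mkcond pp /=.
rewrite -/(nu_trunc p r).
case: ifP => pr; last by ring.
have -> : nu_trunc p (r %/ p) = nu_trunc p r.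
  by rewrite -[in RHS](divnK pr) mulnC nu_trunc_mulp.
by ring.
Qed.

Lemma nu_den_ge (x : R) : 2 <= x -> 7 / 16 * x ^ 4 <= x ^ 4 - 2 * x ^ 2 - x + 1.
Proof.
move=> x2; have : 0 <= (x - 2) * x by nra.
have : 0 <= (x - 2) * x ^ 2 by nra.
have : 0 <= (x - 2) * x ^ 3 by have : 0 <= x ^ 3; [apply: pow_le|]; nra.
by nra.
Qed.

Lemma prime_INR_ge2 (p : nat) : prime p -> 2 <= INR p.
Proof. by move=> /prime_gt1 p1; apply: (le_INR 2); lia. Qed.

Lemma div_quartic_le (p : nat) (x D K : R) : prime p -> 7 / 16 * INR p ^ 4 <= D ->
  Rabs x <= K * INR p ^ 2 -> Rabs (x / D) <= 6 * K / INR p.+1 ^ 2.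
Proof.
move=> /prime_INR_ge2 p2 Dp xK; rewrite S_INR.
have p4 : 0 < INR p ^ 4 by apply: pow_lt; lra.
rewrite Rabs_mult Rabs_inv (Rabs_right D); last lra.
apply/Rle_div_l; first lra.
have K0 : 0 <= K by have := Rabs_pos x; nra.
apply: Rle_trans xK _.
rewrite (_ : 6 * K / _ * D = K * (6 * D / (INR p + 1) ^ 2)); last by field; lra.
apply: Rmult_le_compat_l => //.
apply/(Rle_div_r (INR p ^ 2)); first nra.
have p1_le : (INR p + 1) ^ 2 <= 9 / 4 * INR p ^ 2 by nra.
have : INR p ^ 2 * (INR p + 1) ^ 2 <= INR p ^ 2 * (9 / 4 * INR p ^ 2).
  by apply: Rmult_le_compat_l => //; apply: pow2_ge_0.
by lra.
Qed.

Definition linear_correction (p : nat) : R := nu_weight p * INR p - / INR p.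

Definition mean_factor (p : nat) : R := (1 + INR p * nu_weight p) * (1 - / INR p).

Lemma mean_factorE (p : nat) : prime p ->
  mean_factor p = 1 + linear_correction p - nu_weight p.
Proof.
by move=> /prime_INR_ge2 p2; rewrite /mean_factor /linear_correction; field; lra.
Qed.

Lemma nu_weight_le (p : nat) : prime p -> Rabs (nu_weight p) <= 6 / INR p.+1 ^ 2.
Proof.
move=> pp; have p2 := prime_INR_ge2 pp; rewrite -[6]Rmult_1_r.
apply: div_quartic_le => //; first exact: nu_den_ge.
by rewrite Rmult_1_l Rabs_right; [lra|apply: Rle_ge; apply: pow2_ge_0].
Qed.

Lemma linear_correction_le (p : nat) : prime p ->
  Rabs (linear_correction p) <= 12 / INR p.+1 ^ 2.
Proof.
move=> pp; have p2 := prime_INR_ge2 pp; have den := nu_den_ge p2.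
have p4 : 0 < INR p ^ 4 by apply: pow_lt; lra.
rewrite (_ : linear_correction p =
    (2 * INR p + 1 - / INR p) / (INR p ^ 4 - 2 * INR p ^ 2 - INR p + 1)).
  rewrite (_ : 12 = 6 * 2); last by ring.
  apply: div_quartic_le => //; have i0 : 0 < / INR p by apply: Rinv_0_lt_compat; lra.
  have i1 : / INR p <= / 2 by apply: Rinv_le_contravar; lra.
  by rewrite Rabs_right; nra.
by rewrite /linear_correction /nu_weight; field; lra.
Qed.

Lemma euler_convergent_nu : euler_convergent (fun p => 1 + nu_weight p).
Proof.
exists 6 => p pp; rewrite (_ : 1 + _ - 1 = nu_weight p); last by ring.
exact: nu_weight_le.
Qed.

Lemma euler_convergent_mean_factor : euler_convergent mean_factor.
Proof.
exists 18 => p pp; rewrite mean_factorE //.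
rewrite (_ : _ - 1 = linear_correction p + - nu_weight p); last by ring.
apply: Rle_trans (Rabs_triang _ _) _; rewrite Rabs_Ropp.
have := nu_weight_le pp; have := linear_correction_le pp.
by rewrite /Rdiv; lra.
Qed.

(** * From [parabola_moment] to [nu_sum] *)

Lemma eq_rough_dilates (N : nat) (f g : R -> R) (Z : R) : 0 < Z ->
  (forall v, 0 < v -> f v = g v) -> rough_dilates N f Z = rough_dilates N g Z.
Proof.
move=> Z0 fg; apply: eq_rough_series => d /INR_gt0 d0.
by rewrite fg //; apply: Rdiv_lt_0_compat.
Qed.

Lemma linearly_bounded_dilates (C Z : R) (f : R -> R) : linearly_bounded C f -> 0 < Z ->
  inv_square_bounded (C * Z) (fun d => f (Z / INR d) / INR d).
Proof.
by move=> f_lin Z0; apply: inv_square_bounded_dilates => // v [v0 _]; apply: f_lin.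
Qed.

Lemma rough_dilates_bound (N : nat) (C Z : R) (f : R -> R) :
  linearly_bounded C f -> 0 < Z ->
  Rabs (rough_dilates N f Z) <= 2 * C * Z.
Proof.
move=> f_lin Z0; rewrite Rmult_assoc.
exact: rough_series_bound (linearly_bounded_dilates f_lin Z0) N.
Qed.

Lemma rough_dilates_lin (N : nat) (C D a s Z : R) (f g h : R -> R) : 0 < s -> 0 < Z ->
  linearly_bounded C g -> linearly_bounded D h ->
  (forall v, 0 < v -> f v = g v + a * h (v / s)) ->
  rough_dilates N f Z = rough_dilates N g Z + a * rough_dilates N h (Z / s).
Proof.
move=> s0 Z0 g_lin h_lin fE; have Zs0 : 0 < Z / s by apply: Rdiv_lt_0_compat.
rewrite -(rough_series_lin _ _ (linearly_bounded_dilates g_lin Z0)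
  (linearly_bounded_dilates h_lin Zs0)).
apply: eq_rough_series => d /INR_gt0 d0; rewrite fE; last exact: Rdiv_lt_0_compat.
by rewrite (_ : Z / INR d / s = Z / s / INR d); field; lra.
Qed.

Lemma rough_dilates_prime (p : nat) (C Z : R) (f : R -> R) : linearly_bounded C f ->
  prime p -> 0 < Z ->
  rough_dilates p.+1 f Z = rough_dilates p f Z - / INR p * rough_dilates p f (Z / INR p).
Proof.
move=> f_lin pp Z0; have p2 := prime_INR_ge2 pp.
have Zp0 : 0 < Z / INR p by apply: Rdiv_lt_0_compat; lra.
rewrite /rough_dilates (rough_series_prime (linearly_bounded_dilates f_lin Z0) pp).
rewrite -(rough_series_scal _ _ (linearly_bounded_dilates f_lin Zp0)); congr (_ - _).
apply: eq_rough_series => d /INR_gt0 d0; rewrite -multE mult_INR.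
by rewrite (_ : Z / (INR p * INR d) = Z / INR p / INR d); field; lra.
Qed.

Lemma unif_lim_infty_bounded (T : Type) (F : T -> R -> R) (l : T -> R) (L C : R) :
  unif_lim_infty F l -> (forall t, Rabs (l t) <= L) ->
  (forall t Z, 0 < Z -> Rabs (F t Z) <= C * Z) ->
  exists2 B, 0 <= B & forall t Z, 0 < Z -> Rabs (F t Z) <= B.
Proof.
move=> /(_ 1 Rlt_0_1) [Z0 Z0_gt0 F_near] l_le F_le.
have [L0 C0] := (Rabs_pos L, Rabs_pos C).
exists (Rabs L + 1 + Rabs C * Z0) => [|t Z Zgt0]; first nra.
have [ZZ0|ZZ0] := Rle_lt_dec Z0 Z; last first.
  by apply: Rle_trans (F_le t Z Zgt0) _; have := Rle_abs C; nra.
have := F_near t Z ZZ0; have := Rabs_triang (F t Z - l t) (l t).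
rewrite (_ : _ - _ + _ = F t Z); last by ring.
by have := l_le t; have := Rle_abs L; nra.
Qed.

Definition on_primes (x : R) (f : nat -> R) (n : nat) : R := if prime n then f n else x.

Section PrimeCorrections.
Variable j : nat.
Hypothesis j_gt0 : (0 < j)%N.

Definition truncated_sum (N : nat) : R -> R :=
  completed_sum j (nu_trunc N) (prime_prod (fun p => 1 + nu_weight p) N).

Definition nu_sum : R -> R :=
  completed_sum j nu (euler_product (fun p => 1 + nu_weight p)).

Definition sieved_sum (N : nat) : R -> R := rough_dilates N (truncated_sum N).

Lemma truncated_sum0 (Z : R) : 0 < Z -> truncated_sum 0 Z = parabola_moment j Z.
Proof.
move=> Z0; rewrite -completed_sum_cst1 // /truncated_sum /completed_sum /prime_prod.
rewrite big_geq //.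
by congr (_ + _); apply: eq_bigr => r _; rewrite /nu_trunc big_geq.
Qed.

Lemma truncated_sumS_prime (p : nat) (Z : R) : prime p -> 0 < Z ->
  truncated_sum p.+1 Z =
  truncated_sum p Z + INR p * nu_weight p * truncated_sum p (Z / INR p).
Proof.
move=> pp Z0; rewrite /truncated_sum prime_prodS pp.
apply: completed_sum_mul => // [|r _]; first exact: prime_gt0.
exact: nu_truncS_prime.
Qed.

Lemma truncated_sumS_not_prime (N : nat) (Z : R) : ~~ prime N ->
  truncated_sum N.+1 Z = truncated_sum N Z.
Proof.
move=> np; rewrite /truncated_sum prime_prodS (negbTE np) Rmult_1_r; congr (_ + _).
by apply: eq_bigr => r _; rewrite nu_truncS_not_prime.
Qed.

Lemma truncated_sum_linear (N : nat) : exists C, linearly_bounded C (truncated_sum N).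
Proof.
elim: N => [|N [C IH]].
  have [C C0 lip] := parabola_moment_lipschitz j; exists C => Z Z0.
  rewrite truncated_sum0 //; apply: lipschitz_linear lip (parabola_moment0 j) _.
  exact: Rlt_le.
case pN : (prime N); last first.
  by exists C => Z Z0; rewrite truncated_sumS_not_prime ?pN //; apply: IH.
have N2 := prime_INR_ge2 pN.
exists (C + Rabs (nu_weight N) * C) => Z Z0; rewrite truncated_sumS_prime //.
apply: Rle_trans (Rabs_triang _ _) _; rewrite Rmult_plus_distr_r.
apply: Rplus_le_compat; first exact: IH.
have ZN : 0 < Z / INR N by apply: Rdiv_lt_0_compat; lra.
rewrite (Rabs_mult (_ * _)) (Rabs_mult (INR N)) (Rabs_right (INR N)); last lra.
rewrite (_ : _ * C * Z = INR N * Rabs (nu_weight N) * (C * (Z / INR N)));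
  last by field; lra.
apply: Rmult_le_compat_l; last exact: IH.
by apply: Rmult_le_pos; [lra|exact: Rabs_pos].
Qed.

Lemma sieved_sumS_prime (p : nat) (Z : R) : prime p -> 0 < Z ->
  sieved_sum p.+1 Z = sieved_sum p Z + linear_correction p * sieved_sum p (Z / INR p)
    + - nu_weight p * sieved_sum p (Z / INR p ^ 2).
Proof.
move=> pp Z0; have p2 := prime_INR_ge2 pp; have [C lin] := truncated_sum_linear p.
have Zp0 : 0 < Z / INR p by apply: Rdiv_lt_0_compat; lra.
rewrite /sieved_sum.
rewrite (rough_dilates_lin _ _ _ lin lin (fun v v0 => truncated_sumS_prime pp v0)) //;
  last lra.
rewrite !(rough_dilates_prime lin pp) // (_ : Z / INR p ^ 2 = Z / INR p / INR p);
  last by field; lra.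
by rewrite /linear_correction; field; lra.
Qed.

Lemma sieved_sum_rec (N : nat) (Z : R) : 0 < Z ->
  sieved_sum N.+1 Z = sieved_sum N Z
    + on_primes 0 linear_correction N * sieved_sum N (Z / on_primes 1 INR N)
    + on_primes 0 (fun p => - nu_weight p) N * sieved_sum N (Z / on_primes 1 INR N ^ 2).
Proof.
move=> Z0; rewrite /on_primes; case: ifP => pN; first exact: sieved_sumS_prime.
rewrite !Rmult_0_l !Rplus_0_r; have [C lin] := truncated_sum_linear N.
rewrite /sieved_sum.
rewrite (eq_rough_dilates _ Z0 (fun v _ => truncated_sumS_not_prime v (negbT pN))).
exact: rough_series_not_prime (negbT pN).
Qed.

Lemma truncated_sumE (M N : nat) (Z : R) : 0 < Z -> Z <= INR M.+1 -> (M < N)%N ->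
  truncated_sum N Z =
  ramp_sum j nu M Z + prime_prod (fun p => 1 + nu_weight p) N * linear_coef j * Z.
Proof.
move=> Z0 ZM MN; rewrite /truncated_sum (completed_sumE _ _ _ Z0 ZM); congr (_ + _).
rewrite /ramp_sum /kernel_sum big_nat [RHS]big_nat; apply: eq_bigr => r rM.
by rewrite nu_truncE //; lia.
Qed.

Lemma is_lim_truncated_sum (Z : R) : 0 < Z -> is_lim_seq (truncated_sum^~ Z) (nu_sum Z).
Proof.
move=> Z0; have [_ /Rlt_le ZM] := floor_natP (Rlt_le _ _ Z0); set M := floor_nat Z in ZM.
apply: (is_lim_seq_ext_loc (fun N =>
  ramp_sum j nu M Z + linear_coef j * Z * prime_prod (fun p => 1 + nu_weight p) N)).
  by exists M.+1 => N MN; rewrite (truncated_sumE Z0 ZM); [ring|lia].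
rewrite /nu_sum /completed_sum -/M Rmult_assoc (Rmult_comm (euler_product _)).
apply: is_lim_seq_plus'; first exact: is_lim_seq_const.
exact: is_lim_seq_scal_l _ _ (Finite _) (is_lim_euler_product euler_convergent_nu).
Qed.

Lemma truncated_sum_linear_unif (Z : R) : 0 < Z -> exists C, eventually (fun N =>
  forall v, 0 < v <= Z -> Rabs (truncated_sum N v) <= C * v).
Proof.
move=> Z0; have [_ ZM] := floor_natP (Rlt_le _ _ Z0); set M := floor_nat Z in ZM.
have [C lin] := truncated_sum_linear M.+1.
pose G := prime_prod (fun p => 1 + nu_weight p).
pose G_lim := euler_product (fun p => 1 + nu_weight p).
have /is_lim_seq_spec := is_lim_euler_product euler_convergent_nu.
move=> /(_ (mkposreal 1 Rlt_0_1)) [N0 G_near].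
exists (C + (1 + Rabs (G_lim - G M.+1)) * Rabs (linear_coef j)).
exists (maxn N0 M.+1) => N N_ge v [v0 vZ]; have vM : v <= INR M.+1 by lra.
have -> : truncated_sum N v = truncated_sum M.+1 v + (G N - G M.+1) * linear_coef j * v.
  by rewrite !(truncated_sumE v0 vM) /G; [ring| |lia].
apply: Rle_trans (Rabs_triang _ _) _; rewrite Rmult_plus_distr_r.
apply: Rplus_le_compat; first exact: lin.
rewrite (Rabs_mult _ v) (Rabs_mult _ (linear_coef j)) (Rabs_right v); last lra.
apply: Rmult_le_compat_r; first lra.
apply: Rmult_le_compat_r; first exact: Rabs_pos.
have /= := G_near N ltac:(lia); rewrite -/(G N) -/G_lim => G_lt1.
have := Rabs_triang (G N - G_lim) (G_lim - G M.+1).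
by rewrite (_ : _ + _ = G N - G M.+1); [lra|ring].
Qed.

Lemma is_lim_sieved_sum (Z : R) : 0 < Z -> is_lim_seq (sieved_sum^~ Z) (nu_sum Z).
Proof.
move=> Z0; have [C [N0 lin]] := truncated_sum_linear_unif Z0.
have lim0 : is_lim_seq (fun N => sieved_sum N Z - truncated_sum N Z) 0.
  apply/is_lim_seq_spec => eps.
  have [N1 tail_lt] := eventually_div_INR_lt (2 * (C * Z)) (cond_pos eps).
  exists (maxn 2 (maxn N0 N1)) => N N_ge; rewrite Rminus_0_r.
  have bounded := inv_square_bounded_dilates Z0 (lin N ltac:(lia)).
  have := rough_series_head bounded (N := N) ltac:(lia).
  rewrite /= !Rdiv_1_r => head; apply: Rle_lt_trans head _.
  by apply: tail_lt; lia.
apply: (is_lim_seq_ext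
  (fun N => truncated_sum N Z + (sieved_sum N Z - truncated_sum N Z))) => [N|]; first ring.
rewrite -[X in is_lim_seq _ (Finite X)]Rplus_0_r.
by apply: is_lim_seq_plus' lim0; apply: is_lim_truncated_sum.
Qed.

End PrimeCorrections.

Lemma correction_prodE (N : nat) :
  correction_prod (on_primes 0 linear_correction) (on_primes 0 (fun p => - nu_weight p)) N =
  prime_prod mean_factor N.
Proof.
rewrite /prime_prod big_mkcond; apply: eq_bigr => p _; rewrite /on_primes.
by case: ifP => pp; [rewrite mean_factorE //|]; ring.
Qed.

Lemma corrections_coef_le (N : nat) :
  Rabs (on_primes 0 linear_correction N) + Rabs (on_primes 0 (fun p => - nu_weight p) N)
  <= 18 / INR N.+1 ^ 2.
Proof.
rewrite /on_primes; case: ifP => pN; last first.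
  rewrite Rabs_R0 Rplus_0_r; apply: Rdiv_le_0_compat; first lra.
  by apply: pow_lt; apply: INR_gt0.
have := nu_weight_le pN; have := linear_correction_le pN.
by rewrite Rabs_Ropp /Rdiv; lra.
Qed.

Section NuSumSlope.
Variables (j : nat) (Lam : R).
Hypothesis j_gt0 : (0 < j)%N.
Hypothesis Lam_ge0 : 0 <= Lam.

Definition sieved_diff (N : nat) (lam : {x : R | 1 <= x <= Lam}) (Z : R) : R :=
  sieved_sum j N (sval lam * Z) - sieved_sum j N Z.

Lemma dilate_gt0 (lam : {x : R | 1 <= x <= Lam}) (Z : R) : 0 < Z -> 0 < sval lam * Z.
Proof. by case: lam => lam lamL Z0 /=; nra. Qed.

Lemma sieved_diff_rec (N : nat) (lam : {x : R | 1 <= x <= Lam}) (Z : R) : 0 < Z ->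
  sieved_diff N.+1 lam Z = sieved_diff N lam Z
    + on_primes 0 linear_correction N * sieved_diff N lam (Z / on_primes 1 INR N)
    + on_primes 0 (fun p => - nu_weight p) N
      * sieved_diff N lam (Z / on_primes 1 INR N ^ 2).
Proof.
move=> Z0; rewrite /sieved_diff !sieved_sum_rec //; last exact: dilate_gt0.
by rewrite !Rmult_div_assoc; ring.
Qed.

Lemma sieved_diff0_lim :
  unif_lim_infty (sieved_diff 0) (fun lam => mean_moment j * ln (sval lam)).
Proof.
have [C1 C1_gt0 lip] := parabola_moment_lipschitz j.
have [C2 C2_gt0 decay] := parabola_moment_decay j.
have lip' : lipschitz (C1 + C2) (parabola_moment j).
  by move=> x y; apply: Rle_trans (lip x y) _; have := Rabs_pos (x - y); nra.
have decay' : inv_sqrt_decay (C1 + C2) (mean_moment j) (parabola_moment j).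
  move=> v v1; apply: Rle_trans (decay v v1) _; apply: Rmult_le_compat_r; last lra.
  by left; apply: Rinv_0_lt_compat; apply: sqrt_lt_R0; lra.
have C0 : 0 < C1 + C2 by lra.
move=> eps eps0.
have [Z0 Z0_gt0 slope_near] :=
  dilates_slope_unif C0 lip' (parabola_moment0 j) decay' Lam_ge0 eps0.
exists Z0 => // lam Z ZZ0; have Z_gt0 : 0 < Z by lra.
have sieved0 v : 0 < v -> sieved_sum j 0 v = rough_dilates 0 (parabola_moment j) v.
  by move=> v0; apply: eq_rough_dilates => // w; apply: truncated_sum0.
by rewrite /sieved_diff !sieved0 //; [apply: slope_near|apply: dilate_gt0].
Qed.

Lemma mean_moment_ln_le (lam : {x : R | 1 <= x <= Lam}) :
  Rabs (mean_moment j * ln (sval lam)) <= Rabs (mean_moment j) * ln Lam.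
Proof.
case: lam => lam [lam1 lamL] /=; have ln0 := ln_ge0 lam1.
rewrite Rabs_mult (Rabs_right (ln lam)); last lra.
by apply: Rmult_le_compat_l; [exact: Rabs_pos|apply: ln_le; lra].
Qed.

Lemma sieved_diff0_bounded : exists2 B, 0 <= B &
  forall lam Z, 0 < Z -> Rabs (sieved_diff 0 lam Z) <= B.
Proof.
have [C lin] := truncated_sum_linear j_gt0 0.
apply: (unif_lim_infty_bounded (C := 2 * C * Lam + 2 * C) sieved_diff0_lim
  mean_moment_ln_le).
move=> lam Z Z0; have C0 : 0 <= C.
  by have := lin 1 Rlt_0_1; rewrite Rmult_1_r; apply: Rle_trans (Rabs_pos _).
apply: Rle_trans (Rabs_triang _ _) _; rewrite Rabs_Ropp Rmult_plus_distr_r.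
apply: Rplus_le_compat; last exact: rough_dilates_bound.
apply: Rle_trans (rough_dilates_bound _ lin (dilate_gt0 _ Z0)) _.
rewrite (Rmult_assoc (2 * C)); apply: Rmult_le_compat_l; first lra.
by case: lam => lam lamL /=; nra.
Qed.

Lemma nu_sum_slope :
  unif_lim_infty
    (fun (lam : {x : R | 1 <= x <= Lam}) Z => nu_sum j (sval lam * Z) - nu_sum j Z)
    (fun lam => mean_moment j * ln (sval lam) * euler_product mean_factor).
Proof.
have [B B0 bounded] := sieved_diff0_bounded.
apply: (corrections_lim (s := on_primes 1 INR) _ sieved_diff_rec corrections_coef_le B0
  bounded sieved_diff0_lim _ mean_moment_ln_le).
- by move=> N; rewrite /on_primes; case: ifP => [/prime_INR_ge2|_]; lra.
- move=> lam Z Z0; apply: is_lim_seq_minus'; apply: is_lim_sieved_sum => //.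
  exact: dilate_gt0.
- apply: is_lim_seq_ext (is_lim_euler_product euler_convergent_mean_factor) => N.
  by rewrite correction_prodE.
Qed.

End NuSumSlope.

(** * The constants [alpha] and [beta] *)

Definition alpha_factor (n : nat) : R := let p := INR n in
  (1 - p - 2 * p ^ 2 + p ^ 4) / (p ^ 4 - 2 * p ^ 2 + p).

Definition beta_factor (n : nat) : R := let p := INR n in
  (- 1 + p ^ 2 + p ^ 3) / (p * (- 1 + p + p ^ 2)).

Lemma alpha_den_ge (x : R) : 2 <= x -> 7 / 16 * x ^ 4 <= x ^ 4 - 2 * x ^ 2 + x.
Proof. by move=> x2; have := nu_den_ge x2; lra. Qed.

Lemma euler_convergent_alpha : euler_convergent alpha_factor.
Proof.
exists (6 * 1) => p pp; have p2 := prime_INR_ge2 pp; have den := alpha_den_ge p2.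
have p4 : 0 < INR p ^ 4 by apply: pow_lt; lra.
rewrite (_ : alpha_factor p - 1 = (1 - 2 * INR p) / (INR p ^ 4 - 2 * INR p ^ 2 + INR p)).
  by apply: div_quartic_le => //; rewrite Rabs_left1; nra.
by rewrite /alpha_factor; field; lra.
Qed.

Lemma betaE : beta = alpha * euler_product (fun p => 1 + nu_weight p).
Proof.
rewrite /beta -[alpha]/(2 * PI * euler_product alpha_factor) [in RHS]Rmult_assoc.
rewrite -(euler_productM euler_convergent_alpha euler_convergent_nu); congr (_ * _).
apply: (eq_euler_product (f := beta_factor)) => n pn; have p2 := prime_INR_ge2 pn.
have nu_den := nu_den_ge p2; have alpha_den := alpha_den_ge p2.
rewrite /beta_factor /alpha_factor /nu_weight.
have p4 : 0 < INR n ^ 4 by apply: pow_lt; lra.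
by field; repeat split; nra.
Qed.

Lemma euler_product_zeta2 : euler_product (fun p => 1 - / INR p ^ 2) * zeta2 = 1.
Proof.
rewrite /zeta2 (euler_product_inverse (C := 1)).
- by rewrite pow1 Rinv_1.
- move=> d d0; rewrite Rabs_right /Rdiv ?Rmult_1_l; first exact: Rle_refl.
  by apply: Rle_ge; left; apply: Rinv_0_lt_compat; apply: pow_lt; apply: INR_gt0.
- by move=> m n; rewrite -multE mult_INR Rpow_mult_distr Rinv_mult.
exists (6 * 1) => p pp; have p2 := prime_INR_ge2 pp.
rewrite (_ : 1 - / INR p ^ 2 - 1 = - INR p ^ 2 / INR p ^ 4); last by field; lra.
apply: div_quartic_le => //; first by have : 0 < INR p ^ 4; [apply: pow_lt|]; lra.
by rewrite Rabs_left1; have := pow2_ge_0 (INR p); lra.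
Qed.

Lemma alpha_mul_mean_factor : alpha * euler_product mean_factor = 12 / PI.
Proof.
have pi0 := PI_RGT_0; rewrite -[alpha]/(2 * PI * euler_product alpha_factor) Rmult_assoc.
rewrite -(euler_productM euler_convergent_alpha euler_convergent_mean_factor).
rewrite (eq_euler_product (g := fun p => 1 - / INR p ^ 2)); last first.
  move=> n pn; have p2 := prime_INR_ge2 pn.
  have nu_den := nu_den_ge p2; have alpha_den := alpha_den_ge p2.
  have p4 : 0 < INR n ^ 4 by apply: pow_lt; lra.
  by rewrite /alpha_factor /mean_factor /nu_weight; field; repeat split; lra.
have := euler_product_zeta2; rewrite zeta2E; set P := euler_product _ => P_PI.
rewrite (_ : 2 * PI * P = P * (PI ^ 2 / 6) * (12 / PI)); last by field; lra.
by rewrite P_PI Rmult_1_l.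
Qed.

(** * The function [calM] *)

Definition completed_sum_deriv (j : nat) (V : nat -> R) (c Z : R) : R :=
  kernel_sum (ramp_moment_deriv j) V (floor_nat Z) Z + c * linear_coef j.

Definition nu_sum_deriv (j : nat) : R -> R :=
  completed_sum_deriv j nu (euler_product (fun p => 1 + nu_weight p)).

Lemma completed_sum_derivE (j : nat) (V : nat -> R) (c Z : R) (M : nat) : 0 < Z ->
  Z <= INR M.+1 ->
  completed_sum_deriv j V c Z = kernel_sum (ramp_moment_deriv j) V M Z + c * linear_coef j.
Proof.
move=> Z0 ZM; rewrite /completed_sum_deriv (kernel_sum_cutoff _ _ Z0 _ ZM) //.
  exact: ramp_moment_deriv_le1.
by have := @floor_natP Z; lra.
Qed.

Lemma locally_cutoff (Z : R) (P : R -> Prop) : 0 < Z ->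
  (forall z, 0 < z -> z <= INR (floor_nat Z).+1 -> P z) -> locally Z P.
Proof.
move=> Z0 Pz; have [_ ZM] := floor_natP (Rlt_le _ _ Z0).
apply: (locally_interval _ Z 0 (INR (floor_nat Z).+1) Z0 ZM) => z z0 zM.
by apply: Pz => //; apply: Rlt_le; exact: zM.
Qed.

Lemma continuous_div_const (c x : R) : continuous (fun x => x / c) x.
Proof.
by apply: (continuous_mult (fun x => x)); [exact: continuous_id|exact: continuous_const].
Qed.

Lemma continuous_completed_sum_deriv (j : nat) (V : nat -> R) (c Z : R) : 0 < Z ->
  continuous (completed_sum_deriv j V c) Z.
Proof.
move=> Z0; set M := floor_nat Z.
apply: (continuous_ext_loc _
  (fun z => kernel_sum (ramp_moment_deriv j) V M z + c * linear_coef j)).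
  by apply: locally_cutoff => // z z0 zM; rewrite (completed_sum_derivE _ _ _ z0 zM).
apply: (continuous_plus (kernel_sum _ V M)); last exact: continuous_const.
apply: continuous_big_nat => r _; apply: (continuous_mult (fun=> V r)).
  exact: continuous_const.
apply: (continuous_comp (fun z => z / INR r)); first exact: continuous_div_const.
exact: continuous_ramp_moment_deriv.
Qed.

Lemma is_derive_completed_sum (j : nat) (V : nat -> R) (c Z : R) : 0 < Z ->
  is_derive (completed_sum j V c) Z (completed_sum_deriv j V c Z).
Proof.
move=> Z0; have [_ ZM] := floor_natP (Rlt_le _ _ Z0); set M := floor_nat Z in ZM.
apply: (is_derive_ext_loc (fun z => ramp_sum j V M z + c * linear_coef j * z)).
  by apply: locally_cutoff => // z z0 zM; rewrite (completed_sumE _ _ _ z0 zM).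
rewrite /completed_sum_deriv; apply: is_derive_plus; last by auto_derive => //; ring.
apply: is_derive_big_nat => r /andP [/INR_gt0 r0 _].
rewrite (_ : V r * ramp_moment_deriv _ _ =
  V r * INR r * (/ INR r * ramp_moment_deriv j (Z / INR r))); last by field; lra.
apply: is_derive_scal; apply: (is_derive_comp (ramp_moment j) (fun z => z / INR r)).
  by apply: is_derive_ramp_moment; apply: Rdiv_lt_0_compat.
by auto_derive => //; field; lra.
Qed.

Lemma sqrt_mul_chebyshevU (n : nat) (r Z : R) : 0 < r <= Z ->
  sqrt (Z ^ 2 - r ^ 2) * chebyshevU n (r / Z) = Z * sin ((INR n + 1) * arcsec (Z / r)).
Proof.
move=> rZ; have z1 : 1 <= Z / r by apply/Rle_div_r; lra.
have sqrtE : sqrt (Z ^ 2 - r ^ 2) = Z * sin (arcsec (Z / r)).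
  rewrite sin_arcsec // (_ : Z * (_ / (Z / r)) = r * sqrt ((Z / r) ^ 2 - 1));
    last by field; lra.
  rewrite -{2}(sqrt_pow2 r); last lra.
  by rewrite -sqrt_mult_alt; [congr sqrt; field; lra|nra].
have [s0|s0] := Req_dec (sin (arcsec (Z / r))) 0.
  have [p0 p1] := arcsec_bound (Z / r); have pi0 := PI_RGT_0.
  have arcsec0 : arcsec (Z / r) = 0.
    have [pos|//] := p0.
    by have := @sin_gt_0 (arcsec (Z / r)) pos ltac:(lra); lra.
  by rewrite sqrtE arcsec0 !Rmult_0_r sin_0; ring.
rewrite sqrtE (_ : r / Z = cos (arcsec (Z / r))); last by rewrite cos_arcsec //; field; lra.
by rewrite chebyshevU_cos //; field.
Qed.

Lemma sign_sqr (j : nat) : (- 1) ^ j * (- 1) ^ j = 1.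
Proof. by rewrite -Rpow_mult_distr (_ : -1 * -1 = 1) ?pow1; lra. Qed.

Lemma calM_chebyshev_sum (j : nat) (y : R) : 0 < y ->
  \big[Rplus/0]_(1 <= r < (Z.to_nat (Int_part (2 * sqrt y))).+1)
    (nu r * sqrt (4 * y - INR r ^ 2) * chebyshevU (2 * j) (INR r / (2 * sqrt y))) =
  (2 * INR j + 1) * (2 * sqrt y *
    kernel_sum (ramp_moment_deriv j) nu (floor_nat (2 * sqrt y)) (2 * sqrt y)).
Proof.
move=> y0; have sy := sqrt_lt_R0 y y0; have j0 := pos_INR j.
have Z2 : 4 * y = (2 * sqrt y) ^ 2 by rewrite Rpow_mult_distr pow2_sqrt; [ring|lra].
rewrite Z2; set Z := 2 * sqrt y; have Z0 : 0 < Z by rewrite /Z; lra.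
have [floor_le _] := floor_natP (Rlt_le _ _ Z0).
rewrite -/(floor_nat Z) /kernel_sum big_distrr big_distrr big_nat [RHS]big_nat.
apply: eq_bigr => r /andP [r0 rM].
have rZ : 0 < INR r <= Z.
  by split; [exact: INR_gt0|apply: Rle_trans floor_le; apply: le_INR; lia].
rewrite Rmult_assoc sqrt_mul_chebyshevU // -multE mult_INR /ramp_moment_deriv.
by rewrite (_ : INR 2 = 2) //=; field; lra.
Qed.

Lemma calME (j : nat) (y : R) : (0 < j)%N -> 0 < y ->
  calM (2 * j + 2) y =
  alpha * (- 1) ^ j * (2 * sqrt y * nu_sum_deriv j (2 * sqrt y)).
Proof.
move=> j0 y0; have j_ge0 := pos_INR j; rewrite /calM; case: (Rlt_dec 0 y) => [?|//] /=.
have -> : ((2 * j + 2)./2 - 1 = j)%N by lia.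
have -> : (2 * j + 2 - 2 = 2 * j)%N by lia.
have -> : (2 * j + 2 == 2)%N = false by apply/eqP; lia.
have -> : INR (2 * j + 2) = 2 * INR j + 2 by rewrite -plusE -multE plus_INR mult_INR.
rewrite calM_chebyshev_sum // betaE /nu_sum_deriv /completed_sum_deriv /linear_coef.
move: (kernel_sum _ _ _ _) (euler_product _) => S G; set e := (- 1) ^ j.
have -> : alpha * e * (2 * sqrt y * (S + G * (e / (2 * INR j + 1) / 2))) =
    alpha * e * (2 * sqrt y) * S + alpha * (e * e) * G * sqrt y / (2 * INR j + 1).
  by field; lra.
by rewrite sign_sqr; field; lra.
Qed.

Lemma continuous_calM (j : nat) (y : R) : (0 < j)%N -> 0 < y ->
  continuous (calM (2 * j + 2)) y.
Proof.
move=> j0 y0.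
apply: (continuous_ext_loc _ (fun y =>
  alpha * (- 1) ^ j * (2 * sqrt y * nu_sum_deriv j (2 * sqrt y)))).
  by apply: (locally_interval _ y 0 p_infty) => // z z0 _; rewrite calME.
have cZ : continuous (fun y => 2 * sqrt y) y.
  apply: (continuous_mult (fun=> 2)); first exact: continuous_const.
  exact: continuous_sqrt.
apply: (continuous_mult (fun=> _)); first exact: continuous_const.
apply: (continuous_mult (fun y => 2 * sqrt y)) => //.
apply: (continuous_comp (fun y => 2 * sqrt y)) => //.
by apply: continuous_completed_sum_deriv; have := sqrt_lt_R0 y y0; lra.
Qed.

(** * The averages of [calM] *)

Section Dilates.
Variables (f : R -> R) (c : R).
Hypothesis c_ge1 : 1 <= c.
Hypothesis continuous_f : forall v, 0 < v -> continuous f v.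

Definition div_cube_prim (v : R) : R := RInt (fun v => f v / v ^ 3) 1 v.

Lemma is_derive_div_cube_prim (v : R) : 0 < v -> is_derive div_cube_prim v (f v / v ^ 3).
Proof.
have continuous_g w : 0 < w -> continuous (fun v => f v / v ^ 3) w.
  move=> w0; apply: (continuous_mult f); first exact: continuous_f.
  by apply: ex_derive_continuousR; auto_derive; apply: Rgt_not_eq; apply: (pow_lt w 3).
move=> v0; apply: (is_derive_RInt (fun v => f v / v ^ 3) _ 1); last exact: continuous_g.
apply: (locally_interval _ v 0 p_infty) => // b b0 _.
apply: RInt_correct; apply: ex_RInt_continuous => z [z_ge _]; apply: continuous_g.
by apply: Rlt_le_trans z_ge; apply: Rmin_pos; [lra|exact: b0].
Qed.

Lemma is_RInt_dilates (x : R) : 0 < x ->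
  is_RInt (fun u => f (x / u) * u ^ 2 / u) 1 c
    (x ^ 2 * (div_cube_prim x - div_cube_prim (x / c))).
Proof.
move=> x0; pose P u := - x ^ 2 * div_cube_prim (x / u).
rewrite (_ : x ^ 2 * _ = P c - P 1); last by rewrite /P Rdiv_1_r; ring.
apply: is_RInt_antiderivative => // u uc.
  rewrite (_ : _ / u = - x ^ 2 * (- x / u ^ 2 * (f (x / u) / (x / u) ^ 3)));
    last by field; lra.
  apply: is_derive_scal; apply: (is_derive_comp div_cube_prim (fun u => x / u)).
    by apply: is_derive_div_cube_prim; apply: Rdiv_lt_0_compat; lra.
  by auto_derive; [|field]; lra.
apply: (continuous_ext (fun u => f (x / u) * (u ^ 2 / u))).
  by move=> t; rewrite /Rdiv Rmult_assoc.
apply: (continuous_mult (fun u => f (x / u))); last first.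
  by apply: ex_derive_continuousR; auto_derive; lra.
apply: (continuous_comp (fun u => x / u)).
  by apply: ex_derive_continuousR; auto_derive; lra.
by apply: continuous_f; apply: Rdiv_lt_0_compat; lra.
Qed.

Lemma continuous_RInt_dilates (y : R) : 0 < y ->
  continuous (fun x => RInt (fun u => f (x / u) * u ^ 2 / u) 1 c) y.
Proof.
move=> y0; apply: (continuous_ext_loc _
  (fun x => x ^ 2 * (div_cube_prim x - div_cube_prim (x / c)))).
  apply: (locally_interval _ y 0 p_infty) => // x x0 _.
  exact/esym/is_RInt_unique/is_RInt_dilates.
have cP v : 0 < v -> continuous div_cube_prim v.
  by move=> v0; apply: is_derive_continuous (is_derive_div_cube_prim v0).
apply: (continuous_mult (fun x => x ^ 2)).
  by apply: ex_derive_continuousR; auto_derive.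
apply: (continuous_minus div_cube_prim); first exact: cP.
apply: (continuous_comp (fun x => x / c)); first exact: continuous_div_const.
by apply: cP; apply: Rdiv_lt_0_compat; lra.
Qed.

End Dilates.

Lemma RInt_weight (c : R) : 1 <= c -> RInt (fun u => u ^ 2 / u) 1 c = (c ^ 2 - 1) / 2.
Proof.
move=> c1; apply: is_RInt_unique.
apply: (is_RInt_eq (f := fun u => u) c1 _ _
  (is_RInt_antiderivative (F := fun u => u ^ 2 / 2) c1 _ _)) => [u uc||u _|u _].
- by field; lra.
- by field.
- by auto_derive => //; field.
- exact: continuous_id.
Qed.

Lemma calM_avg_continuous (j : nat) (c y : R) : (0 < j)%N -> 1 <= c -> 0 < y ->
  continuous (calM_avg c (2 * j + 2)) y.
Proof.
move=> j0 c1 y0.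
apply: (continuous_mult (fun y => RInt (fun u => calM _ (y / u) * u ^ 2 / u) 1 c));
  last exact: continuous_const.
by apply: continuous_RInt_dilates => // v v0; apply: continuous_calM.
Qed.

Lemma calM_avg0 (c : R) (k : nat) : calM_avg c k 0 = 0.
Proof.
rewrite /calM_avg (_ : RInt _ 1 c = 0); first by rewrite /Rdiv Rmult_0_l.
apply: is_RInt_unique; apply: is_RInt_ext (is_RInt_zero 1 c) => u _.
rewrite /calM Rdiv_0_l; case: (Rlt_dec 0 0) => [/Rlt_irrefl //|_] /=.
by rewrite /Rdiv !Rmult_0_l.
Qed.

Lemma is_RInt_sqr_deriv (L dL : R -> R) (c J : R) : 1 <= c ->
  (forall u, 1 <= u <= c -> is_derive L u (dL u)) ->
  (forall u, 1 <= u <= c -> continuous dL u) ->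
  is_RInt (fun u => u * (L u - L c)) 1 c J ->
  is_RInt (fun u => u ^ 2 * dL u) 1 c (- (L 1 - L c) - 2 * J).
Proof.
move=> c1 DL cdL IJ; pose f u := u ^ 2 * dL u + 2 * (u * (L u - L c)).
have If : is_RInt f 1 c (c ^ 2 * (L c - L c) - 1 ^ 2 * (L 1 - L c)).
  apply: (is_RInt_antiderivative (F := fun u => u ^ 2 * (L u - L c))) => // u uc.
    rewrite /f; auto_derive; first by exists (dL u); apply: DL.
    by rewrite (is_derive_unique (fun x => L x) _ _ (DL u uc)); ring.
  apply: (continuous_plus (fun u => u ^ 2 * dL u)).
    apply: (continuous_mult (fun u => u ^ 2)); last exact: cdL.
    by apply: ex_derive_continuousR; auto_derive.
  apply: is_derive_continuous (_ : is_derive _ _ (2 * ((L u - L c) + u * dL u))).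
  auto_derive; first by exists (dL u); apply: DL.
  by rewrite (is_derive_unique (fun x => L x) _ _ (DL u uc)); ring.
apply: (is_RInt_eq c1 _ _ (is_RInt_Rminus If (is_RInt_Rscal 2 IJ))) => [u _|].
  by rewrite /f; ring.
by ring.
Qed.

Section LogAverage.
Variables (c S e : R) (D : R -> R).
Hypothesis c_ge1 : 1 <= c.
Hypothesis D_close : forall u, 1 <= u <= c -> Rabs (D u - S * (ln (c / u) / 2)) <= e.

Lemma is_RInt_log_weight :
  is_RInt (fun u => u * (ln (c / u) / 2)) 1 c ((c ^ 2 - 1) / 8 - ln c / 4).
Proof.
pose F u := u ^ 2 * ln (c / u) / 4 + u ^ 2 / 8.
rewrite (_ : _ - _ = F c - F 1); last first.
  by rewrite /F Rdiv_1_r Rdiv_diag ?ln_1; [field|lra].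
apply: is_RInt_antiderivative => // u uc.
1,2: have cu : 0 < c / u by apply: Rdiv_lt_0_compat; lra.
  rewrite /F; auto_derive; first by split; [lra|].
  by rewrite -/(Rdiv c u); field; lra.
by apply: ex_derive_continuousR; auto_derive; repeat split; lra.
Qed.

Lemma log_average_close (J : R) : is_RInt (fun u => u * D u) 1 c J ->
  Rabs (2 * D 1 + 4 * J - S * ((c ^ 2 - 1) / 2)) <= (2 + 4 * (c * (c - 1))) * e.
Proof.
move=> IJ; have := D_close (u := 1) ltac:(lra); rewrite Rdiv_1_r => D1_close.
have IE := is_RInt_Rminus IJ (is_RInt_Rscal S is_RInt_log_weight).
have J_close : Rabs (J - S * ((c ^ 2 - 1) / 8 - ln c / 4)) <= (c - 1) * (c * e).
  rewrite -(is_RInt_unique _ _ _ _ IE).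
  apply: abs_RInt_le_const => [||u uc]; [lra|by eexists; exact: IE|].
  rewrite (_ : _ - _ = u * (D u - S * (ln (c / u) / 2))); last by ring.
  rewrite Rabs_mult (Rabs_right u); last lra.
  by apply: Rmult_le_compat; [lra|exact: Rabs_pos|lra|exact: D_close].
move: D1_close J_close => /Rabs_le_between D1_close /Rabs_le_between J_close.
by apply/Rabs_le_between; lra.
Qed.

End LogAverage.

Section AverageLimit.
Variables (j : nat) (c : R).
Hypothesis j_gt0 : (0 < j)%N.
Hypothesis c_gt1 : 1 < c.

Lemma is_derive_nu_sum_sqrt (y u : R) : 0 < y -> 0 < u ->
  is_derive (fun u => nu_sum j (2 * sqrt (y / u))) u
    (- (sqrt (y / u) / u) * nu_sum_deriv j (2 * sqrt (y / u))).
Proof.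
move=> y0 u0; have yu0 : 0 < y / u by apply: Rdiv_lt_0_compat.
have s0 := sqrt_lt_R0 _ yu0.
have ss : sqrt (y / u) * sqrt (y / u) = y / u by apply: sqrt_sqrt; lra.
apply: (is_derive_comp (nu_sum j) (fun u => 2 * sqrt (y / u))).
  by apply: is_derive_completed_sum; lra.
auto_derive; first by split=> //; lra.
rewrite -/(Rdiv y u); set q := sqrt (y / u) in s0 ss *.
have -> : y = q * q * u by rewrite ss; field; lra.
by field; lra.
Qed.

Lemma calM_avg_parts (y : R) : 0 < y ->
  let L u := nu_sum j (2 * sqrt (y / u)) in
  exists2 J, is_RInt (fun u => u * (L u - L c)) 1 c J &
  calM_avg c (2 * j + 2) y =
    alpha * (- 1) ^ j * (2 * (L 1 - L c) + 4 * J) / ((c ^ 2 - 1) / 2).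
Proof.
move=> y0 L; have c1 : 1 <= c by lra.
pose dL u := - (sqrt (y / u) / u) * nu_sum_deriv j (2 * sqrt (y / u)).
have DL u : 1 <= u <= c -> is_derive L u (dL u).
  by move=> uc; apply: is_derive_nu_sum_sqrt; lra.
have cyu u : 1 <= u <= c -> continuous (fun u => sqrt (y / u)) u.
  move=> uc; apply: ex_derive_continuousR; auto_derive; split; first lra.
  by split=> //; apply: Rdiv_lt_0_compat; lra.
have cdL u : 1 <= u <= c -> continuous dL u.
  move=> uc; apply: (continuous_mult (fun u => - (sqrt (y / u) / u))).
    apply: ex_derive_continuousR; auto_derive; repeat split; try lra.
    by apply: Rdiv_lt_0_compat; lra.
  apply: (continuous_comp (fun u => 2 * sqrt (y / u))).
    by apply: (continuous_mult (fun=> 2)); [exact: continuous_const|exact: cyu].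
  apply: continuous_completed_sum_deriv.
  by have := @sqrt_lt_R0 (y / u) ltac:(apply: Rdiv_lt_0_compat; lra); lra.
have [J IJ] : exists J : R, is_RInt (fun u => u * (L u - L c)) 1 c J.
  apply: ex_RInt_continuous_le => // u uc.
  apply: (continuous_mult (fun u => u)); first exact: continuous_id.
  apply: (continuous_minus L); last exact: continuous_const.
  exact: is_derive_continuous (DL u uc).
exists J => //; rewrite /calM_avg RInt_weight //; congr (_ / _); apply: is_RInt_unique.
apply: (is_RInt_eq c1 _ _ (is_RInt_Rscal (- 2 * (alpha * (- 1) ^ j))
  (is_RInt_sqr_deriv c1 DL cdL IJ))) => [u uc|]; last by ring.
by rewrite calME //; [rewrite /dL; field|apply: Rdiv_lt_0_compat]; lra.
Qed.

Lemma nu_sum_log (e : R) : 0 < e -> exists2 Y, 0 < Y & forall y u, Y <= y -> 1 <= u <= c ->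
  Rabs (nu_sum j (2 * sqrt (y / u)) - nu_sum j (2 * sqrt (y / c))
    - mean_moment j * euler_product mean_factor * (ln (c / u) / 2)) <= e.
Proof.
move=> e0; have [Z0 Z0_gt0 slope_near] := nu_sum_slope j_gt0 (sqrt_pos c) e0.
exists (c * Z0 ^ 2) => [|y u yY uc]; first by apply: Rmult_lt_0_compat; [lra|apply: pow_lt].
have cu : 1 <= c / u by apply/Rle_div_r; lra.
have scu : 1 <= sqrt (c / u) <= sqrt c.
  by split; [exact: sqrt_ge1|apply: sqrt_le_1_alt; apply/Rle_div_l; nra].
have yc : Z0 ^ 2 <= y / c by apply/(Rle_div_r (Z0 ^ 2)); lra.
have Zc : Z0 <= 2 * sqrt (y / c).
  have : Z0 <= sqrt (y / c) by rewrite -(sqrt_pow2 Z0); [apply: sqrt_le_1_alt|lra].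
  by have := sqrt_pos (y / c); lra.
have := slope_near (exist _ _ scu) _ Zc; rewrite [sval _]/=.
have -> : sqrt (c / u) * (2 * sqrt (y / c)) = 2 * sqrt (y / u).
  rewrite (_ : y / u = (c / u) * (y / c)); last by field; lra.
  by rewrite sqrt_mult; [ring|lra|have := pow2_ge_0 Z0; lra].
have -> : ln (sqrt (c / u)) = ln (c / u) / 2.
  by rewrite -{2}(sqrt_sqrt (c / u)) ?ln_mult; lra.
by rewrite (_ : _ * _ * euler_product _ =
  mean_moment j * euler_product mean_factor * (ln (c / u) / 2)); last by ring.
Qed.

Lemma is_lim_calM_avg : is_lim (calM_avg c (2 * j + 2)) p_infty (1 / 2).
Proof.
set S := mean_moment j * euler_product mean_factor; set a := alpha * (- 1) ^ j.
have aS : a * S = 1 / 2.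
  rewrite (_ : a * S =
      (alpha * euler_product mean_factor) * ((- 1) ^ j * (- 1) ^ j) * (PI / 24)).
    by rewrite alpha_mul_mean_factor sign_sqr; field; have := PI_RGT_0; lra.
  by rewrite /a /S /mean_moment; field.
have w0 : 0 < (c ^ 2 - 1) / 2 by nra.
have cc0 : 0 <= c * (c - 1) by apply: Rmult_le_pos; lra.
pose K := Rabs a * (2 + 4 * (c * (c - 1))) + 1.
have K0 : 0 < K by have := Rabs_pos a; rewrite /K; nra.
apply/is_lim_spec => eps; have eps0 := cond_pos eps.
pose e := eps * ((c ^ 2 - 1) / 2) / K.
have e0 : 0 < e by apply: Rdiv_lt_0_compat => //; apply: Rmult_lt_0_compat.
have [Y Y0 log_near] := nu_sum_log e0.
exists Y => y yY; have [J IJ ->] := calM_avg_parts (Rlt_trans _ _ _ Y0 yY).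
have := log_average_close (Rlt_le _ _ c_gt1)
  (fun u uc => log_near y u (Rlt_le _ _ yY) uc) IJ.
rewrite -/S -/a; set E := 2 * _ + 4 * _ => close.
rewrite (_ : _ - 1 / 2 = a * (E - S * ((c ^ 2 - 1) / 2)) / ((c ^ 2 - 1) / 2)); last first.
  by rewrite Rmult_minus_distr_l -Rmult_assoc aS; field; nra.
rewrite Rabs_mult Rabs_inv (Rabs_right (_ / 2)); last lra.
apply/Rlt_div_l => //; rewrite Rabs_mult.
apply: Rle_lt_trans (Rmult_le_compat_l _ _ _ (Rabs_pos a) close) _.
have -> : eps * ((c ^ 2 - 1) / 2) = K * e by rewrite /e; field; lra.
by rewrite /K; lra.
Qed.

End AverageLimit.

Theorem theorem6 (RH : RiemannHypothesis) (c : R) (hc : 1 < c)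
    (k : nat) (hk : (6 <= k)%N) (keven : ~~ odd k) :
  (forall y : R, 0 < y -> continuous (calM_avg c k) y)
  /\ calM_avg c k 0 = 0
  /\ is_lim (calM_avg c k) p_infty (Finite (1 / 2)).
Proof.
have [j j0 ->] : exists2 j, (0 < j)%N & k = (2 * j + 2)%N.
  by exists (k./2 - 1)%N; move: (even_halfK keven); lia.
split; first by move=> y; apply: calM_avg_continuous => //; lra.
by split; [apply: calM_avg0|apply: is_lim_calM_avg].
Qed.
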